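(* Given a $2\times 2$ matrix $\mathbf{G}$ with $\det(\mathbf{G})=1$ and $\mathbf{G}^*=\sigma_2\mathbf{G}\sigma_2$, for each $B>0$ and $(X,T)\in\mathbb{R}^2$ we have $$\Psi(X,T;\mathbf{G},B)=B\,\Psi(BX,B^2T;\mathbf{G},1).$$
   Context: Notation: $*$ is complex conjugation (entrywise on matrices, no transpose); $\sigma_2=\begin{bmatrix}0&-\mathrm{i}\\ \mathrm{i}&0\end{bmatrix}$, $\sigma_3=\mathrm{diag}(1,-1)$; $\mathrm{e}^{f\sigma_3}=\mathrm{diag}(\mathrm{e}^{f},\mathrm{e}^{-f})$. For $(X,T)\in\mathbb{R}^2$, $B>0$, and $\mathbf{G}$ with $\det(\mathbf{G})=1$ and $\mathbf{G}^*=\sigma_2\mathbf{G}\sigma_2$, $\mathbf{P}(\Lambda;X,T,\mathbf{G},B)$ denotes the unique (it is known to exist) $2\times2$ matrix function of $\Lambda$ such that: (i) it is analytic for $|\Lambda|\neq1$ and takes continuous boundary values on the unit circle from the interior and from the exterior; (ii) writing $\mathbf{P}_+$ (resp. $\mathbf{P}_-$) for the boundary value on $|\Lambda|=1$ from the exterior (resp. interior), $$\mathbf{P}_+=\mathbf{P}_-\,\mathrm{e}^{-\mathrm{i}(\Lambda X+\Lambda^2T+2B\Lambda^{-1})\sigma_3}\,\mathbf{G}\,\mathrm{e}^{\mathrm{i}(\Lambda X+\Lambda^2T+2B\Lambda^{-1})\sigma_3},\quad|\Lambda|=1;$$ (iii) $\mathbf{P}\to\mathbb{I}$ as $\Lambda\to\infty$.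 Then $\Psi(X,T;\mathbf{G},B):=2\mathrm{i}\lim_{\Lambda\to\infty}\Lambda P_{12}(\Lambda;X,T,\mathbf{G},B)$. *)

(* Defs.v *)
From HB Require Import structures.
From mathcomp Require Import all_boot all_order all_algebra.
From mathcomp Require Import complex.
From mathcomp Require Import all_classical all_reals all_analysis.

Set Implicit Arguments.
Unset Strict Implicit.
Unset Printing Implicit Defensive.

Import Order.TTheory GRing.Theory Num.Theory.
Import numFieldNormedType.Exports.

Local Open Scope classical_set_scope.
Local Open Scope complex_scope.
Local Open Scope ring_scope.

Section RiemannHilbert.
Variable R : realType.
(* [R[i]^o] carries the topology of the complex plane and is a normed module
   over [R[i]] itself ([R[i]] alone is a vector space over [R]), so that
   [derivable P z 1] is complex differentiability of [P] at [z].
   The norm [`|z|] is the modulus, as an element of [R[i]]. *)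
Local Notation C := (R[i]^o).
Local Notation M2 := ('M[R[i]^o]_2).

Implicit Types (X T B : R) (G : M2) (z f : C) (P Q : C -> M2) (D : set C).

Definition mx2 (a b c d : C) : M2 :=
  \matrix_(j, k) if j == 0 then (if k == 0 then a else b)
                 else (if k == 0 then c else d).

Definition sigma2 : M2 := mx2 0 (- 'i%C) 'i%C 0.

Definition cexp z : C :=
  let: x +i* y := z in (expR x)%:C * (cos y +i* sin y).

(* e^{f sigma_3} *)
Definition exp_sigma3 f : M2 := mx2 (cexp f) 0 0 (cexp (- f)).

Definition phase X T B z : C :=
  z * X%:C + z ^+ 2 * T%:C + 2 * B%:C * z^-1.

Definition jump X T G B z : M2 :=
  exp_sigma3 (- ('i%C * phase X T B z)) *m G
    *m exp_sigma3 ('i%C * phase X T B z).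

(* Neighbourhoods of the point at infinity of the Riemann sphere. *)
Definition cinfty : set_system C :=
  [set A | exists M : R, forall z, M%:C < `|z| -> A z].

Global Instance cinfty_filter : ProperFilter cinfty.
Proof.
split; last split.
- move=> [M hM]; apply: (hM (1 + `|M|)%:C).
  rewrite ger0_norm ?lecR ?addr_ge0 ?ler01 ?normr_ge0//.
  by rewrite ltcR (le_lt_trans (ler_norm M))// ltrDr ltr01.
- by exists 0.
- move=> A A' [M hM] [M' hM']; exists (Num.max M M') => z hz.
  by split; [apply: hM|apply: hM'];
    apply: le_lt_trans hz; rewrite lecR le_max lexx ?orbT.
- by move=> A A' AA' [M hM]; exists M => z /hM /AA'.
Qed.

Definition unit_circle : set C := [set z | `|z| = 1].
Definition outside : set C := [set z | 1 < `|z|].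
Definition inside : set C := [set z | `|z| < 1].

Definition boundary_value D P Q : Prop :=
  {within unit_circle, continuous Q} /\
  (forall z, unit_circle z -> P @ within D (nbhs z) --> Q z).

Definition RHP_solution X T G B P : Prop :=
  (forall z, ~ unit_circle z -> derivable P z 1) /\
  (exists Pp Pm : C -> M2,
     [/\ boundary_value outside P Pp,
         boundary_value inside P Pm &
         forall z, unit_circle z -> Pp z = Pm z *m jump X T G B z]) /\
  P @ cinfty --> (1%:M : M2).

(* "The unique solution", as a definite description.  A solution is a function
   on the complement of the unit circle, hence uniqueness is understood up to
   the meaningless values of [P] on the circle.  The identity matrix is only a
   placeholder for the case (which does not occur when [\det G = 1] and
   [G^* = sigma2 G sigma2]) that there is no unique solution. *)
Definition RHP X T G B : C -> M2 :=
  xget (fun=> 1%:M)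
    [set P | RHP_solution X T G B P /\
             forall Q, RHP_solution X T G B Q ->
               forall z, ~ unit_circle z -> Q z = P z].

Definition Psi X T G B : C :=
  2 * 'i%C * lim (z * RHP X T G B z 0 1 @[z --> cinfty]).

End RiemannHilbert.

(* Main.v *)
Require Import Defs.
From mathcomp Require Import all_boot all_order all_algebra.
From mathcomp Require Import complex.
From mathcomp Require Import all_classical all_reals all_analysis.
From mathcomp Require Import ring lra.

(** Write [E_i], [E_o] for the analytic continuations across the unit circle of
    a solution [P], from the inside and from the outside: [E_i] is [P] inside
    and [P * J^-1] outside, [E_o] is [P] outside and [P * J] inside, where [J]
    is the jump, analytic away from 0.  Both are continuous across the circle,
    hence analytic there by Painleve's theorem, and [E_o = E_i * J] on the whole
    punctured plane; the circle no longer plays any role.  Since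
    [J(s z; X, T, B) = J(z; s X, s^2 T, B / s)], rescaling [z] turns such a pair
    into a pair for the rescaled parameters, and the two pieces cut along
    the unit circle again form the new solution.  As [P] itself is only rescaled
    near infinity, [s = B] gives the claim.

    Painleve's theorem reduces by a Cayley transform to a function that is
    analytic off a vertical line and continuous on it.  Goursat's bisection
    still works for such a function, and so does Cauchy's integral formula on a square
    centred on the line, which exhibits the function as a quotient of two Cauchy
    integrals. *)

Set Implicit Arguments.
Unset Strict Implicit.
Unset Printing Implicit Defensive.

Import Order.TTheory GRing.Theory Num.Theory.
Import numFieldNormedType.Exports.
Local Open Scope classical_set_scope.
Local Open Scope complex_scope.
Local Open Scope ring_scope.

(** * Complex modulus *)

Section ComplexModulus.
Variable R : realType.
Local Notation C := (R[i]^o).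
Implicit Types (z w : C).

(** The norm of [R[i]^o] takes its values in [R[i]]; a modulus with values in [R] brings the
    estimates within reach of real arithmetic. *)
Definition cabs z : R := Num.sqrt (complex.Re z ^+ 2 + complex.Im z ^+ 2).

Lemma normr_cabs z : `|z| = (cabs z)%:C.
Proof. exact: normc_def. Qed.

Lemma cabs_ge0 z : 0 <= cabs z. Proof. exact: sqrtr_ge0. Qed.

Lemma cabsM z w : cabs (z * w) = cabs z * cabs w.
Proof. by apply: complexI; rewrite rmorphM/= -!normr_cabs normrM. Qed.

Lemma cabsV z : cabs z^-1 = (cabs z)^-1.
Proof. by apply: complexI; rewrite fmorphV/= -!normr_cabs normfV. Qed.

Lemma cabsN z : cabs (- z) = cabs z.
Proof. by apply: complexI; rewrite -!normr_cabs normrN. Qed.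

Lemma cabsB z w : cabs (z - w) = cabs (w - z).
Proof. by rewrite -cabsN opprB. Qed.

Lemma cabsD z w : cabs (z + w) <= cabs z + cabs w.
Proof. by rewrite -lecR rmorphD/= -!normr_cabs ler_normD. Qed.

Lemma cabs_sub z w : cabs z - cabs w <= cabs (z - w).
Proof. by rewrite lerBlDr (le_trans _ (cabsD _ _))// subrK. Qed.

Lemma cabs0 : cabs 0 = 0.
Proof. by apply: complexI; rewrite -normr_cabs normr0. Qed.

Lemma cabs1 : cabs 1 = 1.
Proof. by apply: complexI; rewrite -normr_cabs normr1. Qed.

Lemma cabsi : cabs 'i%C = 1.
Proof. by rewrite /cabs/= expr0n/= expr1n add0r sqrtr1. Qed.

Lemma cabs_real (x : R) : cabs x%:C = `|x|.
Proof. by rewrite /cabs/= expr0n/= addr0 sqrtr_sqr. Qed.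

Lemma cabs_eq0 z : (cabs z == 0) = (z == 0).
Proof.
by rewrite -(normr_eq0 z) normr_cabs (inj_eq (@complexI R) (cabs z) 0).
Qed.

Lemma cabs_gt0 z : (0 < cabs z) = (z != 0).
Proof. by rewrite lt_def cabs_ge0 andbT cabs_eq0. Qed.

Lemma ler_Re_cabs z : `|complex.Re z| <= cabs z.
Proof. by rewrite -sqrtr_sqr ler_wsqrtr// lerDl sqr_ge0. Qed.

Lemma ler_Im_cabs z : `|complex.Im z| <= cabs z.
Proof. by rewrite -sqrtr_sqr ler_wsqrtr// lerDr sqr_ge0. Qed.

Lemma cabs_le_ReIm z : cabs z <= `|complex.Re z| + `|complex.Im z|.
Proof.
rewrite -[leRHS]ger0_norm ?addr_ge0// -sqrtr_sqr ler_wsqrtr//.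
rewrite -(real_normK (num_real (complex.Re z))).
rewrite -(real_normK (num_real (complex.Im z))).
have := normr_ge0 (complex.Re z); have := normr_ge0 (complex.Im z); nra.
Qed.

Lemma cvg_cabsP {T : Type} {F : set_system T} {FF : Filter F} (f : T -> C) l :
  f @ F --> l <-> forall e : R, 0 < e -> \forall x \near F, cabs (f x - l) < e.
Proof.
split=> [/cvgrPdist_lt fl e e0|fl].
  have /fl : 0 < e%:C :> C by rewrite ltcR.
  by apply: filterS => x; rewrite normr_cabs ltcR cabsB.
apply/cvgrPdist_lt => e e0.
(* Positivity in [R[i]] forces [e] to be real. *)
have eE : e = (complex.Re e)%:C.
  by rewrite RRe_real// gtr0_real.
have /fl : 0 < complex.Re e by rewrite -ltcR -eE.
by apply: filterS => x; rewrite eE normr_cabs ltcR cabsB.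
Qed.

Lemma near_cabsP (z : C) (A : set C) :
  (\forall w \near z, A w) <->
  exists2 e : R, 0 < e & forall w, cabs (w - z) < e -> A w.
Proof.
split=> [/nbhs_ballP[e/= e0 zA]|[e e0 zA]].
  have eE : e = (complex.Re e)%:C by rewrite RRe_real// gtr0_real.
  exists (complex.Re e); first by rewrite -ltcR -eE.
  by move=> w wz; apply: zA; rewrite -ball_normE/= eE normr_cabs ltcR cabsB.
apply/nbhs_ballP; exists e%:C => /=; first by rewrite ltcR.
by move=> w; rewrite -ball_normE/= normr_cabs ltcR cabsB; exact: zA.
Qed.

Lemma continuous_cabsP (f : C -> C) z :
  {for z, continuous f} <-> forall e : R, 0 < e -> exists2 d : R, 0 < d &
    forall w, cabs (w - z) < d -> cabs (f w - f z) < e.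
Proof.
split=> [/cvg_cabsP fz e /fz/near_cabsP//|fz].
apply/(@cvg_cabsP _ (nbhs z) (nbhs_filter z) f (f z)) => e /fz H.
exact/near_cabsP.
Qed.

Lemma cvg_comp_continuous {T : Type} {F : set_system T} {FF : Filter F}
  (f : C -> C) (g : T -> C) (l : C) :
  g @ F --> l -> {for l, continuous f} -> f (g x) @[x --> F] --> f l.
Proof. by move=> gl fl; exact: (continuous_cvg _ fl gl). Qed.

Lemma derivable_cabsP (f : C -> C) z (l : C) :
  (forall e : R, 0 < e -> exists2 d : R, 0 < d &
     forall k : C, k != 0 -> cabs k < d ->
       cabs ((f (z + k) - f z) / k - l) <= e) ->
  is_derive z 1 f l.
Proof.
move=> H.
have K : h^-1 *: (f (h *: 1 + z) - f z) @[h --> (0 : C)^'] --> l.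
  apply/cvg_cabsP => e e0.
  (* Half of [e] turns the non-strict bound into the strict one that convergence asks for. *)
  have [|d d0 Hd] := H (e / 2); first by rewrite divr_gt0.
  have : \forall h \near (0 : C)^', cabs h < d /\ h != 0.
    near=> h; split; near: h; last exact: nbhs_dnbhs_neq.
    apply: nbhs_dnbhs; apply/near_cabsP; exists d => // w.
    by rewrite subr0.
  apply: filterS => h [hd h0].
  rewrite /GRing.scale/= mulr1 mulrC (addrC h z).
  apply: le_lt_trans (Hd h h0 hd) _; lra.
apply: DeriveDef; first by apply/cvg_ex; exists l.
exact: cvg_lim.
Unshelve. all: by end_near. Qed.

(** The difference quotient is multiplied out, so that the increment 0 is covered too; Goursat's
    lemma uses differentiability in this form. *)
Lemma derivable_cabs (f : C -> C) z (l : C) : is_derive z 1 f l ->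
  (forall e : R, 0 < e -> exists2 d : R, 0 < d &
     forall k : C, cabs k < d ->
       cabs (f (z + k) - f z - l * k) <= e * cabs k).
Proof.
move=> [df dl] e e0.
have : h^-1 *: (f (h *: 1 + z) - f z) @[h --> (0 : C)^'] --> l.
  by rewrite -dl; exact: df.
move=> /cvg_cabsP/(_ e e0); case=> d/= d0 Hd.
have dE : d = (complex.Re d)%:C by rewrite RRe_real// gtr0_real.
exists (complex.Re d); first by rewrite -ltcR -dE.
move=> k kd; have [->|k0] := eqVneq k 0.
  by rewrite addr0 subrr mulr0 subr0 cabs0 mulr0.
have := Hd k; rewrite /ball_/= sub0r normrN normr_cabs dE ltcR.
move=> /(_ kd k0); rewrite /GRing.scale/= mulr1 (addrC k z) => /ltW.
move=> /(ler_wpM2r (cabs_ge0 k)); rewrite -cabsM.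
by rewrite mulrBl mulrAC mulVf// mul1r.
Qed.

Lemma derivable_continuous (f : C -> C) z :
  derivable f z 1 -> {for z, continuous f}.
Proof. by move/derivable1_diffP/differentiable_continuous. Qed.

Lemma derivable_near (f g : C -> C) z : (\forall w \near z, f w = g w) ->
  derivable g z 1 -> derivable f z 1.
Proof.
by move=> fg; apply: near_eq_derivable; apply: filterS fg => w ->.
Qed.

Lemma derivable_chain (f g : C -> C) z :
  derivable g z 1 -> derivable f (g z) 1 -> derivable (f \o g) z 1.
Proof.
move=> /derivable1_diffP dg /derivable1_diffP df; apply/derivable1_diffP.
exact: (@differentiable_comp _ _ _ _ g f _ dg df).
Qed.

End ComplexModulus.

(** * Integrals of complex-valued functions *)

Section ComplexIntegral.
Variable R : realType.
Local Notation C := (R[i]^o).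
Local Notation mu := (@lebesgue_measure R).
Implicit Types (f g : R -> C) (a b m t : R).

Definition cint f a b : C :=
  (\int[mu]_(t in `[a, b]) complex.Re (f t)) +i*
  (\int[mu]_(t in `[a, b]) complex.Im (f t)).

Definition cintegrable f a b :=
  mu.-integrable `[a, b] (EFin \o (@complex.Re R \o f)) /\
  mu.-integrable `[a, b] (EFin \o (@complex.Im R \o f)).

Lemma eq_cint {f} g {a b} : (forall t, a <= t <= b -> f t = g t) ->
  cint f a b = cint g a b.
Proof.
by move=> fg; congr (_ +i* _); apply: eq_Rintegral => t;
  rewrite inE/= in_itv/= => /fg ->.
Qed.

Lemma continuous_cintegrable f a b :
  (forall t, a <= t <= b -> {for t, continuous f}) -> cintegrable f a b.
Proof.
move=> cf; split; apply: continuous_compact_integrable;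
  rewrite ?segment_compact//; first exact: segment_compact.
- apply: continuous_subspace_itv => t; rewrite in_itv/= => /cf ft.
  apply/cvgrPdist_lt => e e0; move/cvg_cabsP : ft => /(_ _ e0).
  apply: filterS => u; apply: le_lt_trans.
  by rewrite distrC -raddfB/=; exact: (ler_Re_cabs (f u - f t)).
- exact: segment_compact.
- apply: continuous_subspace_itv => t; rewrite in_itv/= => /cf ft.
  apply/cvgrPdist_lt => e e0; move/cvg_cabsP : ft => /(_ _ e0).
  apply: filterS => u; apply: le_lt_trans.
  by rewrite distrC -raddfB/=; exact: (ler_Im_cabs (f u - f t)).
Qed.

Lemma cintegrableD f g a b : cintegrable f a b -> cintegrable g a b ->
  cintegrable (fun t => f t + g t) a b.
Proof.
move=> [f1 f2] [g1 g2].
have mI : @measurable _ (measurableTypeR R) `[a, b] := measurable_itv _.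
split.
- refine (eq_integrable mI _ _ _ (integrableD mI f1 g1)) => t _ /=.
  by rewrite -EFinD; case: (f t) (g t) => [? ?] [? ?].
- refine (eq_integrable mI _ _ _ (integrableD mI f2 g2)) => t _ /=.
  by rewrite -EFinD; case: (f t) (g t) => [? ?] [? ?].
Qed.

Lemma cintegrableZ (k : C) f a b : cintegrable f a b ->
  cintegrable (fun t => k * f t) a b.
Proof.
case: k => u v [f1 f2].
have mI : @measurable _ (measurableTypeR R) `[a, b] := measurable_itv _.
split.
- refine (eq_integrable mI _ _ _ (integrableB mI (integrableZl mI u f1)
    (integrableZl mI v f2))) => t _ /=.
  by case: (f t).
- refine (eq_integrable mI _ _ _ (integrableD mI (integrableZl mI u f2)
    (integrableZl mI v f1))) => t _ /=.
  by case: (f t).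
Qed.

Lemma cintD f g a b : cintegrable f a b -> cintegrable g a b ->
  cint (fun t => f t + g t) a b = cint f a b + cint g a b.
Proof.
move=> [f1 f2] [g1 g2]; rewrite /cint.
under eq_Rintegral do rewrite raddfD/=.
rewrite RintegralD//.
under [X in _ +i* X]eq_Rintegral do rewrite raddfD/=.
by rewrite RintegralD.
Qed.

Lemma cintZ (k : C) f a b : cintegrable f a b ->
  cint (fun t => k * f t) a b = k * cint f a b.
Proof.
case: k => u v [f1 f2].
have mI : @measurable _ (measurableTypeR R) `[a, b] := measurable_itv _.
rewrite /cint.
rewrite (_ : \int[mu]_(t in `[a, b]) _ =
  \int[mu]_(t in `[a, b]) (u * complex.Re (f t) - v * complex.Im (f t))); last first.
  by apply: eq_Rintegral => t _; case: (f t).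
rewrite (_ : \int[mu]_(t in `[a, b]) complex.Im _ =
  \int[mu]_(t in `[a, b]) (u * complex.Im (f t) + v * complex.Re (f t))); last first.
  by apply: eq_Rintegral => t _; case: (f t).
rewrite RintegralB//; [|exact: (integrableZl mI u f1)|exact: (integrableZl mI v f2)].
rewrite RintegralD//; [|exact: (integrableZl mI u f2)|exact: (integrableZl mI v f1)].
by rewrite !RintegralZl.
Qed.

Lemma cint_cst (k : C) a b : a <= b -> cint (fun=> k) a b = k * (b - a)%:C.
Proof.
move=> ab; rewrite /cint !Rintegral_cst//= lebesgue_measure_itv/= lte_fin.
case: k => u v; move: ab; rewrite le_eqVlt => /predU1P[->|ab].
  by rewrite ltxx subrr !mulr0.
by rewrite ab -EFinB/=; simpc.
Qed.

Lemma cintegrable_sub f a b c d : a <= c -> d <= b -> cintegrable f a b ->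
  cintegrable f c d.
Proof.
move=> ac db [f1 f2]; split; [apply: integrableS f1|apply: integrableS f2] => //;
  by apply: subset_itv; rewrite bnd_simp.
Qed.

Lemma cint_split f m a b : a <= m <= b -> cintegrable f a b ->
  cint f a b = cint f a m + cint f m b.
Proof.
move=> /andP[am mb] fab.
have [[f1 f2] [g1 g2]] := (fab, cintegrable_sub am (lexx b) fab).
rewrite /cint; congr (_ +i* _).
(* Subtracting the integral over [[a, m]] leaves an interval open at [m]; a single point is null, so
   it may be closed. *)
- have := @Rintegral_itvB R _ (BLeft a) (BRight b) m f1.
  rewrite !bnd_simp => /(_ am mb).
  rewrite Rintegral_itv_obnd_cbnd//; last first.
    by apply: integrableS g1 => //; apply: subset_itv; rewrite bnd_simp.
  by move=> <-; rewrite addrC subrK.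
- have := @Rintegral_itvB R _ (BLeft a) (BRight b) m f2.
  rewrite !bnd_simp => /(_ am mb).
  rewrite Rintegral_itv_obnd_cbnd//; last first.
    by apply: integrableS g2 => //; apply: subset_itv; rewrite bnd_simp.
  by move=> <-; rewrite addrC subrK.
Qed.

Lemma Rintegral_bound (h : R -> R) (M : R) a b : a <= b ->
  mu.-integrable `[a, b] (EFin \o h) ->
  (forall t, a <= t <= b -> `|h t| <= M) ->
  `|\int[mu]_(t in `[a, b]) h t| <= M * (b - a).
Proof.
move=> ab ih hM; apply: (le_trans (le_normr_Rintegral _ _)) => //.
have icst : mu.-integrable `[a, b] (EFin \o cst M).
  apply: continuous_compact_integrable; first exact: segment_compact.
  by apply: continuous_subspaceT => x; exact: cvg_cst.
apply: (le_trans (le_Rintegral (f2 := cst M) _ _ _ _)) => //.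
- exact: integrable_norm.
- rewrite Rintegral_cst//= lebesgue_measure_itv/= lte_fin.
  move: ab; rewrite le_eqVlt => /predU1P[->|ab]; first by rewrite ltxx subrr.
  by rewrite ab -EFinB.
Qed.

(** The factor 2 comes from estimating the real and imaginary parts separately. *)
Lemma cabs_cint f (M : R) a b : a <= b -> cintegrable f a b ->
  (forall t, a <= t <= b -> cabs (f t) <= M) ->
  cabs (cint f a b) <= 2 * M * (b - a).
Proof.
move=> ab [f1 f2] fM; apply: (le_trans (cabs_le_ReIm _)) => /=.
have H1 := Rintegral_bound ab f1 (fun t tab => le_trans (ler_Re_cabs _) (fM t tab)).
have H2 := Rintegral_bound ab f2 (fun t tab => le_trans (ler_Im_cabs _) (fM t tab)).
by move: H1 H2; rewrite /=; lra.
Qed.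

End ComplexIntegral.

(** * Integrals along squares *)

Section SquareIntegral.
Variable R : realType.
Local Notation C := (R[i]^o).
Implicit Types (f g : C -> C) (x y h t : R) (z : C).

(** The lower left corner is [x + i y] and the side is [h]. *)
Definition in_square x y h z : Prop :=
  (x <= complex.Re z <= x + h) /\ (y <= complex.Im z <= y + h).

Definition on_square x y h z : Prop := in_square x y h z /\
  [|| complex.Re z == x, complex.Re z == x + h,
      complex.Im z == y | complex.Im z == y + h].

(** This is the contour integral along the boundary, counterclockwise: bottom minus top, plus [i]
    times right minus left. *)
Definition sqint f x y h : C :=
  (cint (fun t => f (t +i* y)) x (x + h) -
   cint (fun t => f (t +i* (y + h))) x (x + h)) +
  'i%C * (cint (fun t => f ((x + h) +i* t)) y (y + h) -
          cint (fun t => f (x +i* t)) y (y + h)).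

Definition sqintegrable f x y h :=
  [/\ cintegrable (fun t => f (t +i* y)) x (x + h),
      cintegrable (fun t => f (t +i* (y + h))) x (x + h),
      cintegrable (fun t => f ((x + h) +i* t)) y (y + h) &
      cintegrable (fun t => f (x +i* t)) y (y + h)].

Lemma continuous_hline f y t : {for t +i* y, continuous f} ->
  {for t, continuous (fun u => f (u +i* y))}.
Proof.
move=> cf; apply: (cvg_comp_continuous _ cf).
apply/cvg_cabsP => e e0; near=> u.
rewrite (_ : _ - _ = (u - t)%:C); last by simpc.
rewrite cabs_real distrC; near: u.
by apply/nbhs_ballP; exists e.
Unshelve. all: by end_near. Qed.

Lemma continuous_vline f x t : {for x +i* t, continuous f} ->
  {for t, continuous (fun u => f (x +i* u))}.
Proof.
move=> cf; apply: (cvg_comp_continuous _ cf).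
apply/cvg_cabsP => e e0; near=> u.
rewrite (_ : _ - _ = 'i%C * (u - t)%:C); last by simpc.
rewrite cabsM cabsi mul1r cabs_real distrC; near: u.
by apply/nbhs_ballP; exists e.
Unshelve. all: by end_near. Qed.

Lemma on_square_edges x y h (P : C -> Prop) : 0 <= h ->
  (forall z, on_square x y h z -> P z) ->
  [/\ forall t, x <= t <= x + h -> P (t +i* y),
      forall t, x <= t <= x + h -> P (t +i* (y + h)),
      forall t, y <= t <= y + h -> P ((x + h) +i* t) &
      forall t, y <= t <= y + h -> P (x +i* t)].
Proof.
move=> h0 HP; split=> t tx; apply: HP; split; rewrite ?eqxx ?orbT//;
  by split; rewrite //= ?lexx ?lerDl ?h0.
Qed.

Lemma continuous_sqintegrable f x y h : 0 <= h ->
  (forall z, on_square x y h z -> {for z, continuous f}) ->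
  sqintegrable f x y h.
Proof.
move=> h0 /(on_square_edges h0)[H1 H2 H3 H4].
split; apply: continuous_cintegrable => t tx.
- exact/continuous_hline/H1.
- exact/continuous_hline/H2.
- exact/continuous_vline/H3.
- exact/continuous_vline/H4.
Qed.

Lemma sqintD f g x y h : sqintegrable f x y h -> sqintegrable g x y h ->
  sqint (fun z => f z + g z) x y h = sqint f x y h + sqint g x y h.
Proof.
move=> [f1 f2 f3 f4] [g1 g2 g3 g4]; rewrite /sqint !cintD//; ring.
Qed.

Lemma sqintZ (k : C) f x y h : sqintegrable f x y h ->
  sqint (fun z => k * f z) x y h = k * sqint f x y h.
Proof. by move=> [f1 f2 f3 f4]; rewrite /sqint !cintZ//; ring. Qed.

Lemma sqintegrableZ (k : C) f x y h : sqintegrable f x y h ->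
  sqintegrable (fun z => k * f z) x y h.
Proof. by move=> [f1 f2 f3 f4]; split; exact: cintegrableZ. Qed.

Lemma sqintegrableD f g x y h : sqintegrable f x y h -> sqintegrable g x y h ->
  sqintegrable (fun z => f z + g z) x y h.
Proof. by move=> [? ? ? ?] [? ? ? ?]; split; exact: cintegrableD. Qed.

Lemma eq_sqint f g x y h : 0 <= h ->
  (forall z, on_square x y h z -> f z = g z) ->
  sqint f x y h = sqint g x y h.
Proof.
move=> h0 /(on_square_edges h0)[H1 H2 H3 H4]; rewrite /sqint.
by rewrite (eq_cint H1) (eq_cint H2) (eq_cint H3) (eq_cint H4).
Qed.

(** Four edges, each with the factor 2 of [cabs_cint], make 8. *)
Lemma cabs_sqint f x y h (M : R) : 0 <= h -> sqintegrable f x y h ->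
  (forall z, on_square x y h z -> cabs (f z) <= M) ->
  cabs (sqint f x y h) <= 8 * M * h.
Proof.
move=> h0 [f1 f2 f3 f4] /(on_square_edges h0)[H1 H2 H3 H4].
have xh : x <= x + h by rewrite lerDl.
have yh : y <= y + h by rewrite lerDl.
have E1 := cabs_cint xh f1 H1; have E2 := cabs_cint xh f2 H2.
have E3 := cabs_cint yh f3 H3; have E4 := cabs_cint yh f4 H4.
rewrite /sqint; apply: (le_trans (cabsD _ _)).
rewrite cabsM cabsi mul1r.
apply: (le_trans (lerD (cabsD _ _) (cabsD _ _))); rewrite !cabsN.
by move: E1 E2 E3 E4; lra.
Qed.

Lemma sqint_cst (k : C) x y h : 0 <= h -> sqint (fun=> k) x y h = 0.
Proof. by move=> h0; rewrite /sqint !cint_cst ?lerDl//; ring. Qed.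

(** Opposite edges differ by a constant translation, [i h] for the horizontal pair and [h] for the
    vertical one; the resulting contributions [- i h ^ 2] and [i h ^ 2] cancel. *)
Lemma sqint_id x y h : 0 <= h -> sqint id x y h = 0.
Proof.
move=> h0.
have [i1 i2 i3 i4] : sqintegrable id x y h.
  by apply: (continuous_sqintegrable h0) => z _; exact: cvg_id.
rewrite /sqint.
have -> : cint (fun t => id (t +i* y)) x (x + h) -
   cint (fun t => id (t +i* (y + h))) x (x + h) = cint (fun=> - (h *i)) x (x + h).
  rewrite -[- cint _ _ _]mulN1r -cintZ// -cintD//; last exact: cintegrableZ.
  by apply: eq_cint => t _ /=; rewrite mulN1r; simpc; congr (_ +i* _); ring.
have -> : cint (fun t => id ((x + h) +i* t)) y (y + h) -
   cint (fun t => id (x +i* t)) y (y + h) = cint (fun=> h%:C) y (y + h).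
  rewrite -[- cint _ _ _]mulN1r -cintZ// -cintD//; last exact: cintegrableZ.
  by apply: eq_cint => t _ /=; rewrite mulN1r; simpc; congr (_ +i* _); ring.
by rewrite !cint_cst ?lerDl//; simpc; congr (_ +i* _); ring.
Qed.

(** The outer edges are cut at their midpoints, and every inner edge occurs twice with opposite
    signs. *)
Lemma sqint_split f x y h : 0 <= h ->
  (forall z, in_square x y (h + h) z -> {for z, continuous f}) ->
  sqint f x y (h + h) = sqint f x y h + sqint f (x + h) y h +
    sqint f x (y + h) h + sqint f (x + h) (y + h) h.
Proof.
move=> h0 cf.
have H u : y <= u <= y + (h + h) ->
    cintegrable (fun t => f (t +i* u)) x (x + (h + h)).
  by move=> yu; apply: continuous_cintegrable => t tx;
    apply: continuous_hline; apply: cf.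
have V u : x <= u <= x + (h + h) ->
    cintegrable (fun t => f (u +i* t)) y (y + (h + h)).
  by move=> yu; apply: continuous_cintegrable => t tx;
    apply: continuous_vline; apply: cf.
have xm : x <= x + h <= x + (h + h) by move: h0; lra.
have ym : y <= y + h <= y + (h + h) by move: h0; lra.
have Hs u (yu : y <= u <= y + (h + h)) := cint_split xm (H u yu).
have Vs u (xu : x <= u <= x + (h + h)) := cint_split ym (V u xu).
have E (a : R) : a + h + h = a + (h + h) by rewrite addrA.
rewrite /sqint !E.
have [b1 b2] : (y <= y <= y + (h + h)) /\ (y <= y + (h + h) <= y + (h + h)).
  by move: h0; split; lra.
have [b3 b4] : (x <= x <= x + (h + h)) /\ (x <= x + (h + h) <= x + (h + h)).
  by move: h0; split; lra.
rewrite (Hs _ b1) (Hs _ b2) (Vs _ b3) (Vs _ b4).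
ring.
Qed.

End SquareIntegral.

(** * Goursat's lemma *)

Section Goursat.
Variable R : realType.
Local Notation C := (R[i]^o).
Implicit Types (f g : C -> C) (x y h t : R) (z : C).

(** Every left endpoint lies below every right endpoint, so the supremum of the left endpoints
    works. *)
Lemma nested_intervals (a b : nat -> R) :
  (forall n, a n <= a n.+1) -> (forall n, b n.+1 <= b n) ->
  (forall n, a n <= b n) -> exists p, forall n, a n <= p <= b n.
Proof.
move=> /nondecreasing_seqP aS /nonincreasing_seqP bS ab.
have amb m n : a m <= b n.
  have [mn|/ltnW nm] := leqP m n; first exact: le_trans (aS _ _ mn) (ab n).
  exact: le_trans (ab m) (bS _ _ nm).
have sa : has_sup (range a).
  by split; [exists (a 0), 0|exists (b 0) => _ [m _ <-]].
exists (sup (range a)) => n; apply/andP; split.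
  by apply: ub_le_sup; [exact: sa.2|exists n].
by apply: ge_sup; [exact: sa.1|move=> _ [m _ <-]].
Qed.

(** If [P] failed, one quarter of each failing square would fail as well; these nested squares
    shrink to a point, near which the local hypothesis excludes failure. *)
Lemma square_bisection (P : R -> R -> R -> Prop) x0 y0 h0 : 0 < h0 ->
  (forall x y h, 0 < h -> P x y h -> P (x + h) y h -> P x (y + h) h ->
     P (x + h) (y + h) h -> P x y (h + h)) ->
  (forall p q, x0 <= p <= x0 + h0 -> y0 <= q <= y0 + h0 ->
     exists2 d : R, 0 < d & forall x y h, 0 < h < d ->
       x <= p <= x + h -> y <= q <= y + h -> P x y h) ->
  P x0 y0 h0.
Proof.
move=> h0_gt0 Psplit Ploc; apply: contrapT => nP0.
(* A square is coded as [((x, y), h)], and [F] sends a failing square to a failing quarter of it. *)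
have /choice[F HF] : forall s : R * R * R, exists s' : R * R * R,
    0 < s.2 -> ~ P s.1.1 s.1.2 s.2 ->
    [/\ ~ P s'.1.1 s'.1.2 s'.2, s'.2 = s.2 / 2,
      s.1.1 <= s'.1.1, s'.1.1 + s'.2 <= s.1.1 + s.2 &
      s.1.2 <= s'.1.2 /\ s'.1.2 + s'.2 <= s.1.2 + s.2].
  move=> [[x y] h] /=.
  have hE : h = h / 2 + h / 2 by rewrite -splitr.
  have [H1|H1] := pselect (P x y (h / 2)); last first.
    by exists (x, y, h / 2) => /= h_gt0 _;
      split => //; last split; move: h_gt0; lra.
  have [H2|H2] := pselect (P (x + h / 2) y (h / 2)); last first.
    by exists (x + h / 2, y, h / 2) => /= h_gt0 _;
      split => //; last split; move: h_gt0; lra.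
  have [H3|H3] := pselect (P x (y + h / 2) (h / 2)); last first.
    by exists (x, y + h / 2, h / 2) => /= h_gt0 _;
      split => //; last split; move: h_gt0; lra.
  exists (x + h / 2, y + h / 2, h / 2) => /= h_gt0 nP.
  have H4 : ~ P (x + h / 2) (y + h / 2) (h / 2).
    by move=> H4; apply: nP; rewrite hE; apply: Psplit => //; rewrite divr_gt0.
  by split => //; last split; move: h_gt0; lra.
pose s n := iter n F (x0, y0, h0).
have s_ n : (s n).2 = h0 / 2 ^+ n /\ ~ P (s n).1.1 (s n).1.2 (s n).2.
  elim: n => [|n [IH1 IH2]]; first by rewrite expr0 divr1.
  have sn0 : 0 < (s n).2 by rewrite IH1 divr_gt0// exprn_gt0.
  have [H1 H2 _ _ _] := HF _ sn0 IH2.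
  by split => //; rewrite /= H2 IH1 exprSr invfM mulrA.
have s_gt0 n : 0 < (s n).2 by rewrite (s_ n).1 divr_gt0// exprn_gt0.
have sS n := HF _ (s_gt0 n) (s_ n).2.
have [p Hp] : exists p, forall n, (s n).1.1 <= p <= (s n).1.1 + (s n).2.
  apply: (@nested_intervals (fun n => (s n).1.1)
    (fun n => (s n).1.1 + (s n).2)) => n; last by rewrite lerDl ltW.
  - by case: (sS n).
  - by case: (sS n).
have [q Hq] : exists q, forall n, (s n).1.2 <= q <= (s n).1.2 + (s n).2.
  apply: (@nested_intervals (fun n => (s n).1.2)
    (fun n => (s n).1.2 + (s n).2)) => n; last by rewrite lerDl ltW.
  - by case: (sS n) => _ _ _ _ [].
  - by case: (sS n) => _ _ _ _ [].
have [d d0 Hd] := Ploc p q (Hp 0) (Hq 0).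
have [n hn] : exists n, h0 / 2 ^+ n < d.
  have [n hn] : exists n, h0 / d < n%:R.
    by exists (Num.truncn (h0 / d)).+1; rewrite truncnS_gt.
  exists n; rewrite ltr_pdivrMr ?exprn_gt0// mulrC -ltr_pdivrMr//.
  by apply: lt_trans hn _; rewrite -natrX ltr_nat ltn_expl.
apply: (s_ n).2; apply: Hd; [|exact: Hp|exact: Hq].
by rewrite s_gt0 (s_ n).1.
Qed.

(* A vertical line counts twice if it crosses the interior of the strip
   [a, b] and once if it bounds it: this is additive under bisection and at
   least 1 whenever the line meets the strip.  The squares of side h meeting
   the exceptional lines are thus few enough for mere continuity to control
   the sum of their integrals. *)
Definition lines_weight (s : seq R) (a b : R) : R :=
  \sum_(c <- s) ((a <= c < b)%R + (a < c <= b)%R)%N%:R.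

Lemma lines_weight_ge0 s a b : 0 <= lines_weight s a b.
Proof. exact: sumr_ge0. Qed.

Lemma lines_weight_split s a m b : a < m < b ->
  lines_weight s a b = lines_weight s a m + lines_weight s m b.
Proof.
move=> /andP[am mb]; rewrite /lines_weight -big_split/=; apply: eq_bigr => c _.
rewrite -natrD; congr _%:R.
(* A line at [m] weighs 2 in the whole and 1 in each half; any other line weighs 0 in the half on
   the far side of [m]. *)
have [cm|mc|->] := ltgtP c m.
- by rewrite (lt_trans cm mb) (ltW (lt_trans cm mb)) /= ?andbF ?addn0.
- by rewrite (lt_trans am mc) (ltW (lt_trans am mc)) /= ?andbF ?add0n.
- by rewrite am mb (ltW am) (ltW mb).
Qed.

Lemma lines_weight_ge1 s c a b : c \in s -> a <= c <= b -> a < b ->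
  1 <= lines_weight s a b.
Proof.
move=> cs /andP[ac cb] ab; rewrite /lines_weight (big_rem c)//=.
rewrite ler_wpDr ?sumr_ge0//; rewrite -[leLHS]/(1%:R) ler_nat ac cb andbT /=.
have [->|cb'] := eqVneq c b; first by rewrite ab addnC.
by rewrite lt_neqAle cb' cb.
Qed.

(** Affine functions integrate to 0 around a square, so a Taylor polynomial of degree at most 1 can
    be subtracted freely. *)
Lemma sqint_sub_affine f (c l : C) x y h : 0 <= h ->
  (forall z, on_square x y h z -> {for z, continuous f}) ->
  sqint f x y h = sqint (fun z => f z - (c + l * (z : C))) x y h.
Proof.
move=> h0 cf.
have sid : sqintegrable id x y h.
  by apply: (continuous_sqintegrable h0) => z _; exact: cvg_id.
have sc : sqintegrable (fun=> c) x y h.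
  by apply: (continuous_sqintegrable h0) => z _; exact: cst_continuous.
have sf := continuous_sqintegrable h0 cf.
have -> : (fun z => f z - (c + l * (z : C))) =
   (fun z => f z + -1 * (c + l * id z)).
  by apply/funext => z; rewrite mulN1r.
have sl := sqintegrableZ l sid.
rewrite sqintD//; last by apply: sqintegrableZ; exact: sqintegrableD.
rewrite sqintZ; last exact: sqintegrableD.
by rewrite sqintD// sqintZ// sqint_cst// sqint_id// mulr0 addr0 mulr0 addr0.
Qed.

Lemma continuous_sub_affine f (c l : C) z : {for z, continuous f} ->
  {for z, continuous (fun z => f z - (c + l * (z : C)))}.
Proof.
move=> fz; apply: (@cvgB _ _ _ _ _ f (fun w => c + l * (w : C)) _ _ fz).
apply: (@cvgD _ _ _ _ _ (fun=> c) (fun w => l * (w : C))).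
  exact: cst_continuous.
exact: mulrl_continuous.
Qed.

Lemma in_square_cabs x y h p q z :
  x <= p <= x + h -> y <= q <= y + h -> in_square x y h z ->
  cabs (z - (p +i* q)) <= 2 * h.
Proof.
case: z => u v xp yq [/= xu yv]; apply: le_trans (cabs_le_ReIm _) _ => /=.
have : `|u - p| <= h by rewrite ler_norml; move: xp xu; lra.
have : `|v - q| <= h by rewrite ler_norml; move: yq yv; lra.
lra.
Qed.

(** The bound [e * (h ^+ 2 + weight * h)] is additive under bisection and need only be checked on
    small squares. Near a differentiable point the area term pays, near an exceptional line the
    weight term does. Finally [e] tends to 0. *)
Lemma goursat f (s : seq R) x0 y0 h0 : 0 < h0 ->
  (forall z, in_square x0 y0 h0 z -> {for z, continuous f}) ->
  (forall z, in_square x0 y0 h0 z -> complex.Re z \notin s ->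
     derivable f z 1) ->
  sqint f x0 y0 h0 = 0.
Proof.
move=> h0_gt0 cf df; apply/eqP; rewrite -cabs_eq0 eq_le cabs_ge0 andbT.
pose K := h0 ^+ 2 + lines_weight s x0 (x0 + h0) * h0.
have K0 : 0 < K.
  by rewrite ltr_wpDr ?exprn_gt0// mulr_ge0 ?lines_weight_ge0// ltW.
suff H e : 0 < e -> cabs (sqint f x0 y0 h0) <= e * K.
  apply/ler_addgt0Pl => e e0; rewrite addr0.
  by have := H (e / K); rewrite divr_gt0// divfK ?gt_eqF//; exact.
move=> e0.
pose P x y h := x0 <= x -> x + h <= x0 + h0 -> y0 <= y -> y + h <= y0 + h0 ->
  cabs (sqint f x y h) <= e * (h ^+ 2 + lines_weight s x (x + h) * h).
suff : P x0 y0 h0 by apply.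
apply: square_bisection => // [x y h h_gt0 P1 P2 P3 P4 x0x xx0 y0y yy0|p q px qy].
  rewrite sqint_split; [|exact: ltW|]; last first.
    move=> z [zx zy]; apply: cf; split; move: zx zy x0x xx0 y0y yy0; lra.
  have {}P1 : cabs (sqint f x y h) <= e * (h ^+ 2 + lines_weight s x (x + h) * h).
    by apply: P1; move: h_gt0 x0x xx0 y0y yy0; clear; lra.
  have {}P2 : cabs (sqint f (x + h) y h) <=
      e * (h ^+ 2 + lines_weight s (x + h) (x + h + h) * h).
    by apply: P2; move: h_gt0 x0x xx0 y0y yy0; clear; lra.
  have {}P3 : cabs (sqint f x (y + h) h) <=
      e * (h ^+ 2 + lines_weight s x (x + h) * h).
    by apply: P3; move: h_gt0 x0x xx0 y0y yy0; clear; lra.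
  have {}P4 : cabs (sqint f (x + h) (y + h) h) <=
      e * (h ^+ 2 + lines_weight s (x + h) (x + h + h) * h).
    by apply: P4; move: h_gt0 x0x xx0 y0y yy0; clear; lra.
  rewrite (@lines_weight_split s x (x + h)); last by move: h_gt0; clear; lra.
  rewrite (addrA x h h).
  set w1 := lines_weight s x (x + h); set w2 := lines_weight s (x + h) (x + h + h).
  have -> : e * ((h + h) ^+ 2 + (w1 + w2) * (h + h)) =
    e * (h ^+ 2 + w1 * h) + e * (h ^+ 2 + w2 * h) +
    e * (h ^+ 2 + w1 * h) + e * (h ^+ 2 + w2 * h) by ring.
  apply: (le_trans (cabsD _ _)); apply: lerD; last exact: P4.
  apply: (le_trans (cabsD _ _)); apply: lerD; last exact: P3.
  by apply: (le_trans (cabsD _ _)); apply: lerD; [exact: P1|exact: P2].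
have z0_in : in_square x0 y0 h0 (p +i* q) by [].
have [ps|ps] := boolP (p \in s).
(* On an exceptional line, [f] is compared with a constant. An error [e / 8] against the factor 8 of
   [cabs_sqint] leaves [e * h], which a weight of at least 1 absorbs. *)
- have /cvg_cabsP/(_ (e / 8)) := cf _ z0_in.
  rewrite divr_gt0// => /(_ isT)/near_cabsP[d d0 Hd].
  exists (d / 2); first by rewrite divr_gt0.
  move=> x y h /andP[h_gt0 hd] xp yq x0x xx0 y0y yy0.
  have cf' z : in_square x y h z -> {for z, continuous f}.
    by move=> [zx zy]; apply: cf; split; move: zx zy x0x xx0 y0y yy0; lra.
  rewrite (@sqint_sub_affine f (f (p +i* q)) 0); [|exact: ltW|by move=> z []/cf'].
  have : cabs (sqint (fun z => f z - (f (p +i* q) + 0 * (z : C))) x y h) <= 8 * (e / 8) * h.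
    apply: cabs_sqint; first exact: ltW.
    - apply: continuous_sqintegrable; first exact: ltW.
      by move=> z [/cf' fz _]; exact: continuous_sub_affine.
    - move=> z [zs _]; rewrite mul0r addr0 ltW//; apply: Hd.
      by apply: le_lt_trans (in_square_cabs xp yq zs) _; move: hd; lra.
  move=> /le_trans; apply.
  have : 1 <= lines_weight s x (x + h).
    by apply: lines_weight_ge1 ps xp _; rewrite ltrDl.
  rewrite mulrCA mulfV ?mulr1// => H.
  apply: ler_wpM2l; first exact: ltW.
  apply: ler_wpDl; first by rewrite exprn_ge0// ltW.
  by rewrite ler_peMl// ltW.
(* Points of the square lie within [2 * h] of the base point, so the affine error is at most
   [e / 16 * (2 * h)], and [8 * h] times this is [e * h ^+ 2]. *)
- have /derivableP/derivable_cabs/(_ (e / 16)) := df _ z0_in ps.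
  rewrite divr_gt0// => /(_ isT)[d d0 Hd].
  set l := 'D_1 f _ in Hd; set z0 := p +i* q in Hd.
  exists (d / 2); first by rewrite divr_gt0.
  move=> x y h /andP[h_gt0 hd] xp yq x0x xx0 y0y yy0.
  have cf' z : in_square x y h z -> {for z, continuous f}.
    by move=> [zx zy]; apply: cf; split; move: zx zy x0x xx0 y0y yy0; lra.
  rewrite (@sqint_sub_affine f (f z0 - l * z0) l); [|exact: ltW|by move=> z []/cf'].
  have : cabs (sqint (fun z => f z - (f z0 - l * z0 + l * (z : C))) x y h)
      <= 8 * (e / 16 * (2 * h)) * h.
    apply: cabs_sqint; first exact: ltW.
    - apply: continuous_sqintegrable; first exact: ltW.
      by move=> z [/cf' fz _]; exact: continuous_sub_affine.
    - move=> z [zs _]; have zz0 := in_square_cabs xp yq zs.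
      have /Hd : cabs (z - z0) < d by apply: le_lt_trans zz0 _; move: hd; lra.
      rewrite (addrC z0) subrK => H.
      have -> : f z - (f z0 - l * z0 + l * z) = f z - f z0 - l * (z - z0) by ring.
      by apply: le_trans H _; rewrite ler_wpM2l// divr_ge0// ltW.
  move=> /le_trans; apply.
  have -> : 8 * (e / 16 * (2 * h)) * h = e * h ^+ 2 by field.
  apply: ler_wpM2l; first exact: ltW.
  by rewrite ler_wpDr// mulr_ge0 ?lines_weight_ge0// ltW.
Qed.

End Goursat.

(** * Cauchy integrals *)

Section RemovableLine.
Variable R : realType.
Local Notation C := (R[i]^o).
Implicit Types (f g : C -> C) (x y h t r : R) (z p : C).

Lemma for_continuousM f g z : {for z, continuous f} -> {for z, continuous g} ->
  {for z, continuous (fun w => f w * g w)}.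
Proof. by move=> cf cg; exact: (cvgM cf cg). Qed.

Lemma for_continuousB f g z : {for z, continuous f} -> {for z, continuous g} ->
  {for z, continuous (fun w => f w - g w)}.
Proof. by move=> cf cg; exact: (cvgB cf cg). Qed.

Lemma for_continuous_inv p z : z != p ->
  {for z, continuous (fun w : C => (w - p)^-1)}.
Proof.
move=> zp; apply: derivable_continuous.
apply: (@derivableV _ _ (fun w : C => w - p)); first by rewrite subr_eq0.
by apply: derivableB; [exact: derivable_id|exact: derivable_cst].
Qed.

Lemma on_square_cabs r z : 0 <= r -> on_square (- r) (- r) (2 * r) z ->
  r <= cabs z.
Proof.
move=> r0 [_ /or4P[]/eqP zr].
- by apply: le_trans (ler_Re_cabs z); rewrite zr normrN ger0_norm.
- by apply: le_trans (ler_Re_cabs z); rewrite zr ler_normr; apply/orP; left; lra.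
- by apply: le_trans (ler_Im_cabs z); rewrite zr normrN ger0_norm.
- by apply: le_trans (ler_Im_cabs z); rewrite zr ler_normr; apply/orP; left; lra.
Qed.

Lemma in_centered_square r z : in_square (- r) (- r) (2 * r) z ->
  cabs z <= 2 * r.
Proof.
move=> [zr1 zr2]; apply: le_trans (cabs_le_ReIm z) _.
have : `|complex.Re z| <= r by rewrite ler_norml; move: zr1; clear; lra.
have : `|complex.Im z| <= r by rewrite ler_norml; move: zr2; clear; lra.
lra.
Qed.

(** Differentiation under the integral sign: the kernel at [p + k] is expanded to first order in
    [k], with an exact remainder that is bounded uniformly on the contour. *)
Lemma derivable_cauchy_integral (phi : C -> C) r (M : R) p : 0 < r ->
  (forall z, on_square (- r) (- r) (2 * r) z -> {for z, continuous phi}) ->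
  (forall z, on_square (- r) (- r) (2 * r) z -> cabs (phi z) <= M) ->
  cabs p < r / 2 ->
  derivable (fun p => sqint (fun z => phi z * (z - p)^-1)
                        (- r) (- r) (2 * r)) p 1.
Proof.
move=> r0 cphi Mphi pr; have h0 : 0 <= 2 * r by lra.
(* The radius [3 / 4 * r] leaves room for increments below [r / 4] around [p], and still keeps
   distance [r / 4] from the contour. *)
have dist (q : C) z : cabs q < 3 / 4 * r -> on_square (- r) (- r) (2 * r) z ->
    r / 4 <= cabs (z - q).
  move=> qr /(on_square_cabs (ltW r0)) rz.
  by have := cabs_sub z q; move: qr rz r0; lra.
have M0 : 0 <= M.
  apply: le_trans (cabs_ge0 (phi (- r +i* - r))) _; apply: Mphi.
  by split; [split => /=; move: r0; lra|rewrite eqxx].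
have neq (q : C) z : cabs q < 3 / 4 * r -> on_square (- r) (- r) (2 * r) z ->
    z != q.
  move=> qr /(dist _ _ qr) zq; rewrite -subr_eq0 -cabs_gt0.
  by apply: lt_le_trans zq; rewrite divr_gt0.
have pr' : cabs p < 3 / 4 * r by move: pr r0; lra.
pose g1 z := phi z * (z - p)^-1.
pose g2 z := phi z * (z - p)^-1 * (z - p)^-1.
pose g3 (k z : C) := phi z * (z - p)^-1 * (z - p)^-1 * (z - (p + k))^-1.
have cg1 z : on_square (- r) (- r) (2 * r) z -> {for z, continuous g1}.
  by move=> zr; apply: for_continuousM (for_continuous_inv (neq _ _ pr' zr));
    exact: cphi.
have cg2 z : on_square (- r) (- r) (2 * r) z -> {for z, continuous g2}.
  by move=> zr; apply: for_continuousM (for_continuous_inv (neq _ _ pr' zr));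
    exact: cg1.
have cg3 k : cabs (p + k) < 3 / 4 * r ->
   forall z, on_square (- r) (- r) (2 * r) z -> {for z, continuous (g3 k)}.
  by move=> kr z zr; apply: for_continuousM (for_continuous_inv (neq _ _ kr zr));
    exact: cg2.
pose K := 8 * (M * (r / 4)^-1 * (r / 4)^-1 * (r / 4)^-1) * (2 * r).
have K0 : 0 <= K.
  by rewrite !mulr_ge0// ?invr_ge0; move: r0; lra.
suff [] : is_derive p 1 (fun p => sqint (fun z => phi z * (z - p)^-1)
            (- r) (- r) (2 * r)) (sqint g2 (- r) (- r) (2 * r)) by [].
apply: derivable_cabsP => e e0.
(* The first bound keeps [p + k] away from the contour, the second makes the remainder [cabs k * K]
   at most [e]; adding 1 guards against [K = 0]. *)
exists (Num.min (r / 4) (e / (K + 1))).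
  by rewrite lt_min !divr_gt0//; move: K0; lra.
move=> k k0; rewrite lt_min => /andP[kr ke].
have pkr : cabs (p + k) < 3 / 4 * r.
  by apply: le_lt_trans (cabsD _ _) _; move: pr kr; lra.
have i1 := continuous_sqintegrable h0 cg1.
have i2 := continuous_sqintegrable h0 cg2.
have i3 := continuous_sqintegrable h0 (cg3 _ pkr).
have -> : sqint (fun z => phi z * (z - (p + k))^-1) (- r) (- r) (2 * r) =
    sqint g1 (- r) (- r) (2 * r) + k * sqint g2 (- r) (- r) (2 * r) +
    k * k * sqint (g3 k) (- r) (- r) (2 * r).
  have j2 := sqintegrableZ k i2; have j3 := sqintegrableZ (k * k) i3.
  rewrite -(sqintZ k i2) -(sqintZ (k * k) i3) -(sqintD i1 j2).
  rewrite -(sqintD (sqintegrableD i1 j2) j3).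
  apply: eq_sqint => // z zr; rewrite /g1 /g2 /g3.
  have := neq _ _ pr' zr; have := neq _ _ pkr zr.
  rewrite -(subr_eq0 z p) -(subr_eq0 z (p + k)) => zpk zp.
  by field; rewrite zpk zp.
rewrite (_ : _ - _ = k * sqint (g3 k) (- r) (- r) (2 * r)); last first.
  by rewrite -/g1; field.
rewrite cabsM.
have : cabs (sqint (g3 k) (- r) (- r) (2 * r)) <= K.
  apply: cabs_sqint => // z zr; rewrite /g3 !cabsM !cabsV.
  have r4 : 0 < r / 4 by rewrite divr_gt0.
  have V (q : C) : cabs q < 3 / 4 * r -> (cabs (z - q))^-1 <= (r / 4)^-1.
    move=> /dist/(_ zr) H; rewrite lef_pV2 ?posrE//.
    exact: lt_le_trans H.
  by rewrite !ler_pM ?mulr_ge0 ?invr_ge0 ?cabs_ge0 ?V ?Mphi.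
have K1 : 0 < K + 1 by move: K0; lra.
move: ke; rewrite ltr_pdivlMr// => ke H.
apply: le_trans (_ : cabs k * K <= _).
  by rewrite ler_wpM2l ?cabs_ge0.
by move: ke; have := cabs_ge0 k; lra.
Qed.

Lemma invcE (a b : R) : (a +i* b)^-1 =
  (a / (a ^+ 2 + b ^+ 2)) +i* (- (b / (a ^+ 2 + b ^+ 2))) :> C.
Proof. by []. Qed.

(** Together the four edges give [4 r i] times the integral of [1 / (t ^ 2 + r ^ 2)] over
    [[- r, r]], whose integrand is at least [1 / (2 r ^ 2)]. The integrand is shaped as the Cauchy
    kernel of the constant 1 at the point 0. *)
Lemma winding_square_neq0 r : 0 < r ->
  sqint (fun z => 1 * (z - 0)^-1) (- r) (- r) (2 * r) != 0 :> C.
Proof.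
move=> r0; have h0 : 0 <= 2 * r by lra.
pose q t := (t ^+ 2 + r ^+ 2)^-1.
have qd t : 0 < t ^+ 2 + r ^+ 2 by rewrite ltr_wpDl ?sqr_ge0// exprn_gt0.
have rr : - r + 2 * r = r by ring.
have [i1 i2 i3 i4] : sqintegrable (fun z : C => 1 * (z - 0)^-1) (- r) (- r) (2 * r).
  apply: (continuous_sqintegrable h0) => z zr.
  apply: for_continuousM; first exact: cst_continuous.
  apply: for_continuous_inv; rewrite -cabs_gt0.
  exact: lt_le_trans (on_square_cabs (ltW r0) zr).
have ab : - r <= r by lra.
have icont : forall t, {for t, continuous q}.
  move=> t; apply: cvgV; first by rewrite gt_eqF.
  apply: cvgD; last exact: cst_continuous.
  exact: exprn_continuous.
have iq : (@lebesgue_measure R).-integrable `[- r, r] (EFin \o q).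
  apply: continuous_compact_integrable; first exact: segment_compact.
  by apply: continuous_subspaceT => t; exact: icont.
have icq : cintegrable (fun t => (q t)%:C) (- r) r.
  split => //; apply: (eq_integrable _ (EFin \o cst (0 : R))) => //.
  apply: continuous_compact_integrable; first exact: segment_compact.
  by apply: continuous_subspaceT => t; exact: cst_continuous.
have -> : sqint (fun z => 1 * (z - 0)^-1) (- r) (- r) (2 * r) =
    (4 * r) *i * cint (fun t => (q t)%:C) (- r) r.
  rewrite /sqint rr in i1 i2 i3 i4 *.
  rewrite -[- cint _ _ _]mulN1r -cintZ// -cintD//; last exact: cintegrableZ.
  rewrite -[- cint (fun t => _ * (- r +i* t - 0)^-1) _ _]mulN1r.
  rewrite -cintZ// -cintD//; last exact: cintegrableZ.
  rewrite -cintZ//; last by apply: cintegrableD => //; exact: cintegrableZ.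
  rewrite -cintD; last 2 first.
  - by apply: cintegrableD => //; exact: cintegrableZ.
  - by apply: cintegrableZ; apply: cintegrableD => //; exact: cintegrableZ.
  rewrite -cintZ//; apply: eq_cint => t _.
  rewrite !mul1r !subr0 !mulN1r !invcE /q sqrrN (addrC (r ^+ 2)).
  move: (qd t); rewrite lt0r => /andP[qd0 _].
  simpc; congr (_ +i* _); field => //.
rewrite mulf_neq0//; first by rewrite eq_complex/= negb_and mulf_neq0 ?orbT// gt_eqF.
suff : 0 < complex.Re (cint (fun t => (q t)%:C) (- r) r).
  by apply: contraTneq => ->; rewrite ltxx.
rewrite /=; apply: lt_le_trans (_ : (2 * r ^+ 2)^-1 * (r - - r) <= _).
  by rewrite mulr_gt0 ?invr_gt0 ?mulr_gt0 ?exprn_gt0//; lra.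
have icst : (@lebesgue_measure R).-integrable `[- r, r] (EFin \o cst (2 * r ^+ 2)^-1).
  apply: continuous_compact_integrable; first exact: segment_compact.
  by apply: continuous_subspaceT => x; exact: cst_continuous.
have := @le_Rintegral _ _ _ (@lebesgue_measure R) _ _ _ (measurable_itv `[- r, r]) icst iq.
rewrite Rintegral_cst//= lebesgue_measure_itv/= lte_fin.
have -> : - r < r by lra.
apply => t; rewrite in_itv/= => tr; rewrite /q lef_pV2 ?posrE ?mulr_gt0 ?exprn_gt0//.
by move: tr; nra.
Qed.

End RemovableLine.

(** * Removable curves *)

Section Painleve.
Variable R : realType.
Local Notation C := (R[i]^o).
Implicit Types (f g : C -> C) (z w p : C).

Lemma continuous_eq0 (P : set C) f p : {for p, continuous f} ->
  (forall e : R, 0 < e -> exists2 w, P w & cabs (w - p) < e) ->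
  (\forall w \near p, P w -> f w = 0) -> f p = 0.
Proof.
move=> /cvg_cabsP cf dP fP; apply/eqP/negPn/negP => fp0.
have fp_gt0 : 0 < cabs (f p) by rewrite cabs_gt0.
have : \forall w \near p, (P w -> f w = 0) /\ cabs (f w - f p) < cabs (f p).
  by apply: filterI => //; exact: cf.
move=> /near_cabsP[d d0 Hd].
have [w Pw wp] := dP d d0.
have [/(_ Pw) ->] := Hd w wp.
by rewrite sub0r cabsN ltxx.
Qed.

(** With [A] and [W] the Cauchy integrals of [f] and of 1, Goursat's lemma for the difference
    quotient gives [f * W = A] off the line, and density gives it on the line. As [W] does not
    vanish near 0, [f = A / W] there. *)
Lemma removable_line f :
  (\forall z \near (0 : C), {for z, continuous f}) ->
  (\forall z \near (0 : C), complex.Re z != 0 -> derivable f z 1) ->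
  derivable f 0 1.
Proof.
move=> cf df.
have c0 : {for (0 : C), continuous f} by exact: nbhs_singleton cf.
have bf : \forall z \near (0 : C), cabs (f z) <= cabs (f 0) + 1.
  move/cvg_cabsP : c0 => /(_ _ ltr01); apply: filterS => z.
  by have := cabs_sub (f z) (f 0); lra.
have : \forall z \near (0 : C), [/\ {for z, continuous f},
    complex.Re z != 0 -> derivable f z 1 & cabs (f z) <= cabs (f 0) + 1].
  by apply: filterS3 cf df bf => z.
move=> /near_cabsP[d d0 Hd].
(* Points of the square have modulus at most [2 * r], which is less than [d]. *)
pose r := d / 4; have r0 : 0 < r by rewrite divr_gt0.
have h0 : 0 < 2 * r by lra.
have sqd z : in_square (- r) (- r) (2 * r) z -> cabs (z - 0) < d.
  by move=> /in_centered_square; rewrite subr0 /r; move: d0; lra.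
have osqd z : on_square (- r) (- r) (2 * r) z -> cabs (z - 0) < d.
  by move=> [/sqd].
pose A p : C := sqint (fun z => f z * (z - p)^-1) (- r) (- r) (2 * r).
pose W p : C := sqint (fun z => 1 * (z - p)^-1) (- r) (- r) (2 * r).
have dA p : cabs p < r / 2 -> derivable A p 1.
  move=> pr; apply: (@derivable_cauchy_integral _ f _ (cabs (f 0) + 1) _ r0 _ _ pr).
    by move=> z /osqd/Hd[H _ _]; exact: H.
  by move=> z /osqd/Hd[_ _ H]; exact: H.
have dW p : cabs p < r / 2 -> derivable W p 1.
  move=> pr; apply: (@derivable_cauchy_integral _ (fun=> 1) _ 1 _ r0 _ _ pr).
    by move=> z _; exact: cst_continuous.
  by move=> z _; rewrite cabs1.
have neq p z : cabs p < r / 2 -> on_square (- r) (- r) (2 * r) z -> z != p.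
  move=> pr /(on_square_cabs (ltW r0)); apply: contraTneq => ->.
  by rewrite -ltNge; move: pr r0; lra.
have small p : cabs p < r / 2 -> cabs (p - 0) < d.
  by rewrite subr0 /r; move: d0; lra.
have AW p : cabs p < r / 2 -> complex.Re p != 0 -> f p * W p - A p = 0.
  move=> pr p0.
  have dfp : derivable f p 1 by have [_ /(_ p0)] := Hd _ (small _ pr).
  (* The difference quotient, completed at [p] by the derivative so as to be continuous there. *)
  pose q z := if z == p then 'D_1 f p else (f z - f p) * (z - p)^-1.
  have qE z : z != p -> \forall w \near z, q w = (f w - f p) * (w - p)^-1.
    move=> zp; apply/near_cabsP; exists (cabs (z - p)).
      by rewrite cabs_gt0 subr_eq0.
    move=> w wz; rewrite /q ifF//; apply: contraTF wz => /eqP ->.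
    by rewrite cabsB ltxx.
  have dq z : z != p -> derivable f z 1 -> derivable q z 1.
    move=> zp dfz; apply: (derivable_near (qE _ zp)).
    apply: (@derivableM _ _ (fun w => f w - f p) (fun w => (w - p)^-1)).
      by apply: (derivableB dfz); exact: derivable_cst.
    apply: (@derivableV _ _ (fun w : C => w - p)); first by rewrite subr_eq0.
    by apply: derivableB; [exact: derivable_id|exact: derivable_cst].
  have cq z : in_square (- r) (- r) (2 * r) z -> {for z, continuous q}.
    move=> zs; have [zp|zp] := eqVneq z p; last first.
      have H := qE _ zp.
      have qz : q z = (f z - f p) * (z - p)^-1 by rewrite /q (negbTE zp).
      rewrite /prop_for /continuous_at qz.
      apply: cvg_trans; first exact: near_eq_cvg (filterS (fun w => @esym _ _ _) H).
      apply: (@for_continuousM _ (fun w => f w - f p) (fun w => (w - p)^-1)).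
        apply: (@for_continuousB _ f (fun=> f p)); last exact: cst_continuous.
        by have [] := Hd _ (sqd _ zs).
      exact: for_continuous_inv.
    rewrite zp; apply/continuous_cabsP => e e0.
    have /derivable_cabs/(_ (e / 2)) := derivableP dfp.
    rewrite divr_gt0// => /(_ isT)[dl dl0 Hdl].
    exists dl => // w wp.
    rewrite /q eqxx; case: eqVneq => [_|wnp]; first by rewrite subrr cabs0.
    have wp0 : 0 < cabs (w - p) by rewrite cabs_gt0 subr_eq0.
    have := Hdl _ wp; rewrite (addrC p) subrK => H.
    have H2 : cabs ((f w - f p) / (w - p) - 'D_1 f p) * cabs (w - p) <= e / 2 * cabs (w - p).
      rewrite -cabsM mulrBl divfK// subr_eq0//.
    by move: H2; rewrite ler_pM2r// => H2; apply: le_lt_trans H2 _; lra.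
  (* At [p] itself only continuity of [q] has been shown, so the vertical line through [p] joins the
     exceptional lines. *)
  have q0 : sqint q (- r) (- r) (2 * r) = 0.
    apply: (@goursat _ q [:: 0; complex.Re p] _ _ _ h0 cq) => z zs.
    rewrite !inE negb_or => /andP[z0 zp].
    apply: dq; first by apply: contraNneq zp => ->.
    by have [_ /(_ z0)] := Hd _ (sqd _ zs).
  have if1 : sqintegrable (fun z => f z * (z - p)^-1) (- r) (- r) (2 * r).
    apply: (continuous_sqintegrable (ltW h0)) => z zs.
    apply: for_continuousM; first by have [] := Hd _ (osqd _ zs).
    exact/for_continuous_inv/neq.
  have if2 : sqintegrable (fun z => 1 * (z - p)^-1) (- r) (- r) (2 * r).
    apply: (continuous_sqintegrable (ltW h0)) => z zs.
    apply: for_continuousM; first exact: cst_continuous.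
    exact/for_continuous_inv/neq.
  have : sqint q (- r) (- r) (2 * r) = A p + (- f p) * W p.
    rewrite /A /W -(sqintZ (- f p) if2).
    rewrite -(sqintD if1 (sqintegrableZ (- f p) if2)).
    apply: eq_sqint; first exact: ltW.
    move=> z /(neq _ _ pr) zp; rewrite /q (negbTE zp).
    by ring.
  rewrite q0 mulNr => /esym/eqP; rewrite subr_eq0 => /eqP ->.
  exact: subrr.
have AWE p : cabs p < r / 2 -> f p * W p - A p = 0.
  move=> pr.
  apply: (@continuous_eq0 [set w | complex.Re w != 0] (fun p => f p * W p - A p)).
  - apply: (@for_continuousB _ (fun p => f p * W p) A).
      apply: for_continuousM; last exact/derivable_continuous/dW.
      by have [] := Hd _ (small _ pr).
    exact/derivable_continuous/dA.
  - move=> e e0; have [p0|p0] := eqVneq (complex.Re p) 0.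
      exists (p + (e / 2)%:C).
        by rewrite /= raddfD/= p0 add0r gt_eqF// divr_gt0.
      by rewrite addrC addKr cabs_real ger0_norm; lra.
    by exists p; rewrite ?subrr ?cabs0.
  - apply/near_cabsP; exists (r / 2 - cabs p); first by rewrite subr_gt0.
    move=> w wp; apply: AW; have := cabsD (w - p) p; rewrite subrK.
    by move: wp; lra.
have r2 : cabs (0 : C) < r / 2 by rewrite cabs0 divr_gt0.
have W0 : W 0 != 0 by exact: winding_square_neq0.
apply: (@derivable_near _ _ (fun p => A p * (W p)^-1)); last first.
  apply: (@derivableM _ _ A (fun p => (W p)^-1)); first exact: dA.
  by apply: (derivableV W0); exact: dW.
have : \forall p \near (0 : C), W p != 0.
  have /cvg_cabsP/(_ (cabs (W 0))) := derivable_continuous (dW _ r2).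
  rewrite cabs_gt0 => /(_ W0); apply: filterS => p.
  by apply: contraTneq => ->; rewrite sub0r cabsN ltxx.
have : \forall p \near (0 : C), cabs p < r / 2.
  apply/near_cabsP; exists (r / 2); first by rewrite divr_gt0.
  by move=> w; rewrite subr0.
apply: filterS2 => p /AWE/eqP; rewrite subr_eq0 => /eqP <- Wp.
by rewrite mulfK.
Qed.

(* The Cayley transform z0 (1 + w) / (1 - w) maps the imaginary axis to the
   unit circle, which reduces the claim to a straight line. *)
Lemma removable_unit_circle f z0 : cabs z0 = 1 ->
  (\forall z \near z0, {for z, continuous f}) ->
  (\forall z \near z0, cabs z != 1 -> derivable f z 1) ->
  derivable f z0 1.
Proof.
move=> z01 cf df.
have z0n : z0 != 0 by rewrite -cabs_gt0 z01 ltr01.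
pose phi w := z0 * (1 + w) * (1 - w)^-1.
pose psi z := (z - z0) * (z + z0)^-1.
have dphi w : w != 1 -> derivable phi w 1.
  move=> w1; apply: (@derivableM _ _ (fun w => z0 * (1 + w)) (fun w : C => (1 - w)^-1)).
    apply: (@derivableM _ _ (fun=> z0) (fun w : C => 1 + w)).
      exact: derivable_cst.
    by apply: derivableD; [exact: derivable_cst|exact: derivable_id].
  apply: (@derivableV _ _ (fun w : C => 1 - w)); first by rewrite subr_eq0 eq_sym.
  by apply: derivableB; [exact: derivable_cst|exact: derivable_id].
have phi0 : phi 0 = z0 by rewrite /phi addr0 subr0 invr1 !mulr1.
have psi0 : psi z0 = 0 by rewrite /psi subrr mul0r.
have dpsi : derivable psi z0 1.
  apply: (@derivableM _ _ (fun w => w - z0) (fun w : C => (w + z0)^-1)).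
    by apply: derivableB; [exact: derivable_id|exact: derivable_cst].
  apply: (@derivableV _ _ (fun w : C => w + z0)).
    by rewrite -mulr2n mulrn_eq0.
  by apply: derivableD; [exact: derivable_id|exact: derivable_cst].
have cphi (A : set C) : (\forall z \near z0, A z) ->
    \forall w \near (0 : C), A (phi w).
  move=> /near_cabsP[e e0 He]; apply/near_cabsP.
  have [|d d0 Hd] := (continuous_cabsP phi 0).1 _ _ e0.
    by apply: derivable_continuous; apply: dphi; rewrite eq_sym oner_eq0.
  by exists d => // w /Hd; rewrite phi0; exact: He.
have near1 : \forall w \near (0 : C), w != 1.
  apply/near_cabsP; exists 1 => // w; rewrite subr0.
  by apply: contraTneq => ->; rewrite cabs1 ltxx.
(* If [cabs (1 + w) = cabs (1 - w)], then [w] is purely imaginary. *)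
have circle w : w != 1 -> complex.Re w != 0 -> cabs (phi w) != 1.
  move=> w1; apply: contra_neq.
  have w1' : cabs (1 - w) != 0 by rewrite cabs_eq0 subr_eq0 eq_sym.
  rewrite /phi !cabsM z01 mul1r cabsV => /(congr1 ( *%R^~ (cabs (1 - w)))).
  rewrite divfK// mul1r => /(congr1 (fun x => x ^+ 2)).
  rewrite !sqr_sqrtr ?addr_ge0 ?sqr_ge0//.
  by case: w {w1 w1'} => a b /=; nra.
(* Near [z0], [phi] inverts [psi]: since [2 * z0] has modulus 2, [z + z0] does not vanish within
   distance 1 of [z0]. *)
apply: (@derivable_near _ _ ((f \o phi) \o psi)).
  apply/near_cabsP; exists 1 => // z zz0 /=; congr f.
  have zz : z + z0 != 0.
    rewrite -cabs_gt0 (_ : z + z0 = 2 * z0 + (z - z0)); last by ring.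
    have := cabs_sub (2 * z0) (- (z - z0)).
    rewrite opprK cabsM z01 cabsN (_ : cabs 2 = 2); last first.
      by rewrite (_ : 2 = (2 : R)%:C) ?cabs_real ?ger0_norm// rmorph_nat.
    by move: zz0; lra.
  rewrite /phi /psi; field; rewrite zz.
  by rewrite (_ : _ - _ = 2 * z0) ?mulf_neq0 ?pnatr_eq0//; ring.
apply: (derivable_chain dpsi); rewrite psi0.
have cf' : \forall w \near (0 : C), {for phi w, continuous f}.
  exact: (cphi [set z | {for z, continuous f}] cf).
have df' : \forall w \near (0 : C), cabs (phi w) != 1 ->
  derivable f (phi w) 1.
  exact: (cphi [set z | cabs z != 1 -> derivable f z 1] df).
apply: removable_line.
- apply: filterS2 near1 cf' => w w1 fw.
  exact: (@continuous_comp _ _ _ phi f w (derivable_continuous (dphi _ w1)) fw).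
- apply: filterS2 near1 df' => w w1 dw w0.
  exact: (derivable_chain (dphi _ w1) (dw (circle _ w1 w0))).
Qed.

End Painleve.

(** * The exponential and matrix-valued functions *)

Section ComplexExponential.
Variable R : realType.
Local Notation C := (R[i]^o).
Implicit Types (z w k : C).

Lemma cexpD z w : cexp (z + w) = cexp z * cexp w.
Proof.
case: z w => [a b] [c d]; rewrite /cexp /= expRD cosD sinD.
by simpc; congr (_ +i* _); ring.
Qed.

Lemma cexp0 : cexp (0 : C) = 1.
Proof. by rewrite /cexp /= expR0 cos0 sin0; simpc. Qed.

Lemma cexpNM z : cexp (- z) * cexp z = 1.
Proof. by rewrite -cexpD addNr cexp0. Qed.

Lemma is_derive_real (f : R -> R) (l : R) : is_derive (0 : R) (1 : R) f l ->
  forall e : R, 0 < e -> exists2 d : R, 0 < d &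
    forall h, `|h| < d -> `|f h - f 0 - l * h| <= e * `|h|.
Proof.
move=> [df dl] e e0.
have : h^-1 *: (f (h *: 1 + 0) - f 0) @[h --> (0 : R)^'] --> l.
  by rewrite -dl; exact: df.
move=> /cvgrPdist_lt/(_ e e0)[d/= d0 Hd].
exists d => // h hd; have [->|h0] := eqVneq h 0.
  by rewrite subrr mulr0 subr0 normr0 mulr0.
have := Hd h; rewrite /ball_/= sub0r normrN => /(_ hd h0).
rewrite /GRing.scale/= mulr1 addr0 distrC => /ltW.
move=> /(ler_wpM2r (normr_ge0 h)); rewrite -normrM.
by rewrite mulrBl mulrAC mulVf// mul1r.
Qed.

Lemma is_derive_cexp0 : is_derive (0 : C) (1 : C) (@cexp R) 1.
Proof.
apply: derivable_cabsP => e e0.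
(* Each component of the remainder will be at most [3 * e' * cabs k], and 6 / 8 is less than 1. The
   cap 1 serves to bound [E] by 2. *)
pose e' := Num.min 1 (e / 8).
have e'0 : 0 < e' by rewrite lt_min ltr01 divr_gt0.
have [d1 d10 H1] := is_derive_real (is_derive_expR (0 : R)) e'0.
have [d2 d20 H2] := is_derive_real (is_derive_cos (0 : R)) e'0.
have [d3 d30 H3] := is_derive_real (is_derive_sin (0 : R)) e'0.
exists (Num.min (Num.min d1 d2) (Num.min d3 (e' / 2))).
  by rewrite !lt_min d10 d20 d30 divr_gt0.
move=> [a b] k0; rewrite !lt_min => /andP[/andP[k1 k2] /andP[k3 k4]].
have e1 : e' <= 1 by rewrite ge_min lexx.
have e8 : e' <= e / 8 by rewrite ge_min lexx orbT.
set k := a +i* b in k0 k1 k2 k3 k4 *.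
have ak : `|a| <= cabs k := ler_Re_cabs k.
have bk : `|b| <= cabs k := ler_Im_cabs k.
have := H1 a (le_lt_trans ak k1); rewrite expR0 mul1r => {}H1.
have := H2 b (le_lt_trans bk k2); rewrite cos0 sin0 oppr0 mul0r subr0 => {}H2.
have := H3 b (le_lt_trans bk k3); rewrite sin0 cos0 mul1r subr0 => {}H3.
have k_gt0 : 0 < cabs k by rewrite cabs_gt0.
rewrite -(ler_pM2r k_gt0) -cabsM mulrBl divfK// mul1r add0r cexp0.
apply: le_trans (cabs_le_ReIm _) _; rewrite /cexp /=.
rewrite !subr0 !mul0r !addr0.
set E := expR a in H1 *; set c := cos b in H2 *; set s := sin b in H3 *.
have {}H1 : `|E - 1 - a| <= e' * cabs k by apply: le_trans H1 _; rewrite ler_pM2l.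
have {}H2 : `|c - 1| <= e' * cabs k by apply: le_trans H2 _; rewrite ler_pM2l.
have {}H3 : `|s - b| <= e' * cabs k by apply: le_trans H3 _; rewrite ler_pM2l.
have Ea : `|E - 1| <= e'.
  rewrite (_ : E - 1 = E - 1 - a + a); last by ring.
  apply: le_trans (ler_normD _ _) _.
  have := ler_pM (ltW e'0) (ltW k_gt0) e1 (ltW k4); move: k4 ak H1 k_gt0; rewrite mul1r; lra.
have E2 : `|E| <= 2.
  rewrite (_ : E = E - 1 + 1); last by ring.
  by apply: le_trans (ler_normD _ _) _; rewrite normr1; move: Ea e1; lra.
have ke0 : 0 <= e' * cabs k by rewrite mulr_ge0// ltW.
have S1 : `|E * c - 1 - a| <= 3 * (e' * cabs k).
  rewrite (_ : E * c - 1 - a = (E - 1 - a) + E * (c - 1)); last by ring.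
  apply: le_trans (ler_normD _ _) _; rewrite normrM.
  have := ler_pM (normr_ge0 _) (normr_ge0 _) E2 H2; move: H1; lra.
have S2 : `|E * s - b| <= 3 * (e' * cabs k).
  rewrite (_ : E * s - b = E * (s - b) + (E - 1) * b); last by ring.
  apply: le_trans (ler_normD _ _) _; rewrite !normrM.
  have := ler_pM (normr_ge0 _) (normr_ge0 _) E2 H3.
  have := ler_pM (normr_ge0 _) (normr_ge0 _) Ea bk; lra.
have : e' * cabs k <= e / 8 * cabs k by rewrite ler_pM2r.
rewrite ?mul0r ?mulr0 ?subr0 ?addr0 ?add0r.
by move: S1 S2; lra.
Qed.

Lemma derivable_cexp z : derivable (@cexp R) z 1.
Proof.
have [] // : is_derive z (1 : C) (@cexp R) (cexp z).
apply: derivable_cabsP => e e0.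
have K0 : 0 < cabs (cexp z) + 1 by have := cabs_ge0 (cexp z); lra.
have [|d d0 Hd] :=
  derivable_cabs is_derive_cexp0 (e := e / (cabs (cexp z) + 1)).
  by rewrite divr_gt0.
exists d => // k k0 /Hd; rewrite add0r cexp0 mul1r => H.
rewrite cexpD.
have -> : (cexp z * cexp k - cexp z) / k - cexp z = cexp z * (cexp k - 1 - k) / k.
  by field.
rewrite !cabsM cabsV ler_pdivrMr ?cabs_gt0//.
apply: le_trans (ler_wpM2l (cabs_ge0 _) H) _.
rewrite mulrA ler_wpM2r ?cabs_ge0//.
rewrite mulrCA ger_pMr// ler_pdivrMr// mul1r; lra.
Qed.

End ComplexExponential.

(** * Entrywise limits and derivatives of matrix functions *)

Section MatrixFunctions.
Variable R : realType.
Local Notation C := (R[i]^o).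
Local Notation M2 := ('M[R[i]^o]_2).
Implicit Types (z w : C) (P Q : C -> M2).

Lemma cvg_mxP {F : set_system C} {FF : Filter F} P (L : M2) :
  P @ F --> L <-> forall i j, (fun z => P z i j) @ F --> L i j.
Proof.
split=> [PL i j A /= LA|PL A [B LB BA]].
  apply: (PL [set M | A (M i j)]).
  exists (fun i' j' => if (i' == i) && (j' == j) then A else setT).
    by move=> i' j'; case: ifPn => [/andP[/eqP -> /eqP ->]//|_]; exact: filterT.
  by move=> M /(_ i j); rewrite !eqxx.
have : \forall z \near F, forall ij : 'I_2 * 'I_2, B ij.1 ij.2 (P z ij.1 ij.2).
  by apply: filter_forall => ij; exact: (PL _ _ _ (LB ij.1 ij.2)).
by apply: filterS => z Hz; apply: BA => i j; exact: (Hz (i, j)).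
Qed.

Lemma mulmx2E (A B : M2) i j : (A *m B) i j = A i 0 * B 0 j + A i 1 * B 1 j.
Proof. by rewrite mxE big_ord_recl big_ord1; congr (_ + A i _ * B _ j); apply: val_inj. Qed.

Lemma cvg_mulmx {F : set_system C} {FF : Filter F} P Q (K L : M2) :
  P @ F --> K -> Q @ F --> L -> (fun z => P z *m Q z) @ F --> K *m L.
Proof.
move=> /cvg_mxP PK /cvg_mxP QL; apply/cvg_mxP => i j.
rewrite (_ : (fun z => _) = (fun z => P z i 0 * Q z 0 j + P z i 1 * Q z 1 j)); last first.
  by apply/funext => z; rewrite mulmx2E.
rewrite mulmx2E; apply: cvgD; first exact: cvgM (PK i 0) (QL 0 j).
exact: cvgM (PK i 1) (QL 1 j).
Qed.

(** The difference quotient is formed entrywise, and so are limits in the matrix topology. *)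
Lemma derivable_mx2P P z :
  derivable P z 1 <-> forall i j, derivable (fun w => P w i j) z 1.
Proof.
pose q (h : C) := h^-1 *: ((P \o shift z) (h *: 1) - P z).
have qE i j : (fun h => q h i j) =
    (fun h => h^-1 *: (((fun w => P w i j) \o shift z) (h *: 1) - P z i j)).
  by apply/funext => h; rewrite !mxE.
split=> [/cvg_ex[L PL] i j|dP].
  by apply/cvg_ex; exists (L i j); rewrite -qE; exact: ((cvg_mxP q L).1 PL i j).
apply/cvg_ex; exists (\matrix_(i, j) 'D_1 (fun w => P w i j) z).
by apply/cvg_mxP => i j; rewrite mxE (qE i j); exact: dP.
Qed.

Lemma derivable_mulmx P Q z : derivable P z 1 -> derivable Q z 1 ->
  derivable (fun w => P w *m Q w) z 1.
Proof.
move=> /derivable_mx2P dP /derivable_mx2P dQ; apply/derivable_mx2P => i j.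
rewrite (_ : (fun z => _) = (fun z => P z i 0 * Q z 0 j + P z i 1 * Q z 1 j)); last first.
  by apply/funext => w; rewrite mulmx2E.
apply: (@derivableD _ _ _ (fun z => P z i 0 * Q z 0 j) (fun z => P z i 1 * Q z 1 j)).
  exact: (@derivableM _ _ (fun z => P z i 0) (fun z => Q z 0 j) _ _ (dP i 0) (dQ 0 j)).
exact: (@derivableM _ _ (fun z => P z i 1) (fun z => Q z 1 j) _ _ (dP i 1) (dQ 1 j)).
Qed.

Lemma derivable_mx_near P Q z : (\forall w \near z, P w = Q w) ->
  derivable Q z 1 -> derivable P z 1.
Proof.
by move=> PQ; apply: near_eq_derivable; apply: filterS PQ => w ->.
Qed.

Lemma derivable_mx_continuous P z : derivable P z 1 -> P w @[w --> z] --> P z.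
Proof.
move=> /derivable_mx2P dP.
apply/(@cvg_mxP (nbhs z) (nbhs_filter z) P (P z)) => i j.
exact: (derivable_continuous (dP i j)).
Qed.

End MatrixFunctions.

(** * The Riemann-Hilbert problem *)

Section Jump.
Variable R : realType.
Local Notation C := (R[i]^o).
Local Notation M2 := ('M[R[i]^o]_2).
Implicit Types (z w : C) (P Q : C -> M2) (G : M2) (X T B s : R).

Lemma exp_sigma3NM (f : C) : exp_sigma3 (- f) *m exp_sigma3 f = 1%:M.
Proof.
apply/matrixP => i j; rewrite mulmx2E !mxE /= opprK.
case: i => [[|[|//]] ?]; case: j => [[|[|//]] ?] /=;
  by rewrite ?mulr0 ?mul0r ?addr0 ?add0r ?cexpNM// mulrC cexpNM.
Qed.

Lemma exp_sigma3MN (f : C) : exp_sigma3 f *m exp_sigma3 (- f) = 1%:M.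
Proof. by rewrite -{1}(opprK f) exp_sigma3NM. Qed.

(** At a fixed point the jump is a conjugate of [G], hence multiplicative in [G]; inverting the jump
    then amounts to inverting [G]. *)
Lemma jumpM X T G H B z :
  jump X T G B z *m jump X T H B z = jump X T (G *m H) B z.
Proof.
rewrite /jump; move: ('i%C * phase X T B z) => f.
by rewrite !mulmxA -(mulmxA (exp_sigma3 (- f) *m G)) exp_sigma3MN mulmx1.
Qed.

Lemma jump1 X T B z : jump X T 1%:M B z = 1%:M.
Proof. by rewrite /jump mulmx1 exp_sigma3NM. Qed.

(** The monomials [z], [z ^+ 2] and [z^-1] pick up [s], [s ^+ 2] and [s^-1], which the three
    parameters absorb. *)
Lemma phase_scale X T B s z : s != 0 ->
  phase (s * X) (s ^+ 2 * T) (B / s) z = phase X T B (s%:C * z).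
Proof.
move=> s0; rewrite /phase !rmorphM/= fmorphV invfM; ring.
Qed.

Lemma jump_scale X T G B s z : s != 0 ->
  jump (s * X) (s ^+ 2 * T) G (B / s) z = jump X T G B (s%:C * z).
Proof. by move=> s0; rewrite /jump phase_scale. Qed.

Lemma derivable_phase X T B z : z != 0 -> derivable (phase X T B) z 1.
Proof.
move=> z0; rewrite /phase.
apply: (@derivableD _ _ _ (fun z : C => z * X%:C + z ^+ 2 * T%:C)
  (fun z : C => 2 * B%:C * z^-1)).
  apply: (@derivableD _ _ _ (fun z : C => z * X%:C) (fun z : C => z ^+ 2 * T%:C)).
    apply: (@derivableM _ _ (fun z : C => z) (fun=> X%:C : C)).
      exact: derivable_id.
    exact: derivable_cst.
  apply: (@derivableM _ _ (fun z : C => z ^+ 2) (fun=> T%:C : C)).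
    apply: (@derivableM _ _ (fun z : C => z) (fun z : C => z)); exact: derivable_id.
  exact: derivable_cst.
apply: (@derivableM _ _ (fun=> 2 * B%:C : C) (fun z : C => z^-1)).
  exact: derivable_cst.
apply: (@derivableV _ _ (fun z : C => z) _ _ z0); exact: derivable_id.
Qed.

Lemma derivable_exp_sigma3 (f : C -> C) z : derivable f z 1 ->
  derivable (fun w => exp_sigma3 (f w)) z 1.
Proof.
move=> df; apply/derivable_mx2P => i j.
have dN : derivable (fun w => - f w) z 1 := derivableN df.
have -> : (fun w => exp_sigma3 (f w) i j) =
    if i == 0 then (if j == 0 then @cexp R \o f else cst 0)
    else (if j == 0 then cst 0 else @cexp R \o (fun w => - f w)).
  by apply/funext => w; rewrite mxE; case: ifP => _; case: ifP.
case: ifP => _; case: ifP => _.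
- exact: (derivable_chain df (@derivable_cexp R _)).
- exact: derivable_cst.
- exact: derivable_cst.
- exact: (derivable_chain dN (@derivable_cexp R _)).
Qed.

Lemma derivable_jump X T G B z : z != 0 -> derivable (jump X T G B) z 1.
Proof.
move=> z0; rewrite /jump.
have dphi : derivable (fun w : C => 'i%C * phase X T B w : C) z 1.
  apply: (@derivableM _ _ (fun=> 'i%C : C) (phase X T B)).
    exact: derivable_cst.
  exact: derivable_phase.
apply: (@derivable_mulmx _ (fun w => exp_sigma3 (- ('i%C * phase X T B w)) *m G)
  (fun w => exp_sigma3 ('i%C * phase X T B w))).
  apply: (@derivable_mulmx _ (fun w => exp_sigma3 (- ('i%C * phase X T B w)))
    (fun=> G)); last exact: derivable_cst.
  exact: (derivable_exp_sigma3 (derivableN dphi)).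
exact: (derivable_exp_sigma3 dphi).
Qed.

End Jump.

(** * Solutions of the Riemann-Hilbert problem as pairs of analytic continuations *)

Section AnalyticPair.
Variable R : realType.
Local Notation C := (R[i]^o).
Local Notation M2 := ('M[R[i]^o]_2).
Implicit Types (z w : C) (P Q E : C -> M2) (G : M2) (X T B s : R).

Lemma unit_circleE z : unit_circle z <-> cabs z = 1.
Proof.
rewrite /unit_circle/= normr_cabs; split=> [|->//].
exact: (@complexI R (cabs z) 1).
Qed.

Lemma outsideE z : outside z <-> 1 < cabs z.
Proof. by rewrite /outside/= normr_cabs (ltcR 1). Qed.

Lemma insideE z : inside z <-> cabs z < 1.
Proof. by rewrite /inside/= normr_cabs (ltcR _ 1). Qed.

Lemma cabs_lt1_near z : cabs z < 1 -> \forall w \near z, cabs w < 1.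
Proof.
move=> z1; apply/near_cabsP; exists (1 - cabs z); first by rewrite subr_gt0.
by move=> w; have := cabs_sub w z; lra.
Qed.

Lemma cabs_gt1_near z : 1 < cabs z -> \forall w \near z, 1 < cabs w.
Proof.
move=> z1; apply/near_cabsP; exists (cabs z - 1); first by rewrite subr_gt0.
by move=> w; have := cabs_sub z w; rewrite cabsB; lra.
Qed.

Lemma cvg_within_eq (D : set C) P Q z (L : M2) :
  (forall w, D w -> P w = Q w) -> Q @ within D (nbhs z) --> L ->
  P @ within D (nbhs z) --> L.
Proof.
move=> PQ QL A LA; have H : \forall w \near z, D w -> A (Q w) := QL _ LA.
suff : \forall w \near z, D w -> A (P w) by [].
by apply: filterS H => w DA Dw; rewrite PQ//; exact: DA.
Qed.

Lemma cvg_within_restrict (D : set C) P z (L : M2) :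
  P @ nbhs z --> L -> P @ within D (nbhs z) --> L.
Proof. by move=> PL; apply: cvg_trans PL; apply: cvg_app; exact: cvg_within. Qed.

(** The limits from inside, from outside and along the circle add up to continuity at its points,
    and Painleve's theorem then applies to each entry. *)
Lemma derivable_glue E :
  (forall z, cabs z < 1 -> z != 0 -> derivable E z 1) ->
  (forall z, 1 < cabs z -> derivable E z 1) ->
  (forall z, cabs z = 1 -> [/\ E @ within (@inside R) (nbhs z) --> E z,
     E @ within (@outside R) (nbhs z) --> E z &
     E @ within (@unit_circle R) (nbhs z) --> E z]) ->
  forall z, z != 0 -> derivable E z 1.
Proof.
move=> dI dO cE.
have dN z : z != 0 -> cabs z != 1 -> derivable E z 1.
  move=> z0; rewrite neq_lt => /orP[z1|z1]; first exact: dI.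
  exact: dO.
have cC z : cabs z = 1 -> E @ nbhs z --> E z.
  move=> /cE[c1 c2 c3] A EA.
  have H1 : \forall w \near z, inside w -> A (E w) := c1 _ EA.
  have H2 : \forall w \near z, outside w -> A (E w) := c2 _ EA.
  have H3 : \forall w \near z, unit_circle w -> A (E w) := c3 _ EA.
  suff : \forall w \near z, A (E w) by [].
  apply: filterS3 H1 H2 H3 => w H1 H2 H3.
  have [w1|w1|w1] := ltgtP (cabs w) 1.
  - by apply: H1; exact/insideE.
  - by apply: H2; exact/outsideE.
  - by apply: H3; exact/unit_circleE.
have cA z : z != 0 -> E @ nbhs z --> E z.
  move=> z0; have [/cC cEz|z1] := eqVneq (cabs z) 1; first exact: cEz.
  exact: derivable_mx_continuous (dN _ z0 z1).
move=> z z0; have [z1|z1] := eqVneq (cabs z) 1; last exact: dN.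
apply/derivable_mx2P => i j.
have near0 : \forall w \near z, w != 0.
  apply/near_cabsP; exists 1 => // w.
  by apply: contraTneq => ->; rewrite sub0r cabsN z1 ltxx.
apply: removable_unit_circle z1 _ _.
- apply: filterS near0 => w w0.
  exact: ((@cvg_mxP _ (nbhs w) (nbhs_filter w) E (E w)).1 (cA _ w0) i j).
- apply: filterS near0 => w w0 w1.
  exact: ((derivable_mx2P E w).1 (dN _ w0 w1) i j).
Qed.

(* [Ei] and [Eo] continue a solution across the circle from the inside and from
   the outside; the jump matrix is singular at 0, which [Eo] therefore avoids. *)
Definition analytic_pair X T G B (Ei Eo : C -> M2) :=
  [/\ forall z, derivable Ei z 1, forall z, z != 0 -> derivable Eo z 1,
      forall z, z != 0 -> Eo z = Ei z *m jump X T G B z &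
      Eo @ @cinfty R --> (1%:M : M2)].

Lemma neq0_cabs_ge1 z : 1 <= cabs z -> z != 0.
Proof. by move=> z1; rewrite -cabs_gt0 (lt_le_trans ltr01). Qed.

Lemma RHP_solution_pair X T G B P : G \in unitmx -> RHP_solution X T G B P ->
  exists Ei Eo, [/\ analytic_pair X T G B Ei Eo,
    forall z, cabs z < 1 -> Ei z = P z & forall z, 1 < cabs z -> Eo z = P z].
Proof.
move=> uG [dP [[Pp [Pm [[cPp PPp] [cPm PPm] jumpP]]] Pinf]].
pose J := jump X T G B; pose J' := jump X T (invmx G) B.
have JJ' z : J z *m J' z = 1%:M by rewrite jumpM mulmxV// jump1.
have J'J z : J' z *m J z = 1%:M by rewrite jumpM mulVmx// jump1.
have {}dP z : cabs z != 1 -> derivable P z 1.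
  by move=> /eqP z1; apply: dP => /unit_circleE.
have {}jumpP z : cabs z = 1 -> Pp z = Pm z *m J z.
  by move=> z1; apply: jumpP; exact/unit_circleE.
(* On the circle itself the values of [P] carry no information; the boundary values replace them. *)
pose Ei z := if cabs z < 1 then P z else if cabs z == 1 then Pm z else P z *m J' z.
pose Eo z := if 1 < cabs z then P z else if cabs z == 1 then Pp z else P z *m J z.
have Ei_in z : cabs z < 1 -> Ei z = P z by rewrite /Ei => ->.
have Eo_out z : 1 < cabs z -> Eo z = P z by rewrite /Eo => ->.
have Ei_on z : cabs z = 1 -> Ei z = Pm z by rewrite /Ei => ->; rewrite ltxx eqxx.
have Eo_on z : cabs z = 1 -> Eo z = Pp z by rewrite /Eo => ->; rewrite ltxx eqxx.
have Ei_out z : 1 < cabs z -> Ei z = P z *m J' z.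
  by move=> z1; rewrite /Ei ltNge (ltW z1)/= gt_eqF.
have Eo_in z : cabs z < 1 -> Eo z = P z *m J z.
  by move=> z1; rewrite /Eo ltNge (ltW z1)/= lt_eqF.
have cJ H z : cabs z = 1 -> jump X T H B w @[w --> z] --> jump X T H B z.
  move=> z1; apply: derivable_mx_continuous; apply: derivable_jump.
  by apply: neq0_cabs_ge1; rewrite z1.
have dEi0 z : cabs z < 1 -> derivable Ei z 1.
  move=> z1; apply: (@derivable_mx_near _ _ P); last by apply: dP; rewrite lt_eqF.
  by apply: filterS (cabs_lt1_near z1) => w /Ei_in.
have dEo1 z : 1 < cabs z -> derivable Eo z 1.
  move=> z1; apply: (@derivable_mx_near _ _ P); last by apply: dP; rewrite gt_eqF.
  by apply: filterS (cabs_gt1_near z1) => w /Eo_out.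
have dEi z : z != 0 -> derivable Ei z 1.
  apply: derivable_glue => {}z.
  - by move=> z1 _; exact: dEi0.
  - move=> z1; apply: (@derivable_mx_near _ _ (fun z => P z *m J' z)).
      by apply: filterS (cabs_gt1_near z1) => w /Ei_out.
    apply: derivable_mulmx; first by apply: dP; rewrite gt_eqF.
    by apply: derivable_jump; apply: neq0_cabs_ge1; exact: ltW.
  - move=> z1; rewrite (Ei_on _ z1); split.
    + apply: (@cvg_within_eq _ _ P); first by move=> w /insideE/Ei_in.
      by apply: PPm; exact/unit_circleE.
    + apply: (@cvg_within_eq _ _ (fun w => P w *m J' w)).
        by move=> w /outsideE/Ei_out.
      (* The jump condition says exactly that the limit from outside agrees with the inner boundary
         value. *)
      rewrite (_ : Pm z = Pp z *m J' z); last first.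
        by rewrite (jumpP _ z1) -mulmxA JJ' mulmx1.
      apply: cvg_mulmx; first by apply: PPp; exact/unit_circleE.
      by apply: cvg_within_restrict; exact: cJ.
    + apply: (@cvg_within_eq _ _ Pm); first by move=> w /unit_circleE/Ei_on.
      by move/subspace_continuousP : cPm; apply; exact/unit_circleE.
have dEo z : z != 0 -> derivable Eo z 1.
  apply: derivable_glue => {}z.
  - move=> z1 z0; apply: (@derivable_mx_near _ _ (fun z => P z *m J z)).
      by apply: filterS (cabs_lt1_near z1) => w /Eo_in.
    apply: derivable_mulmx; first by apply: dP; rewrite lt_eqF.
    exact: derivable_jump.
  - exact: dEo1.
  - move=> z1; rewrite (Eo_on _ z1); split.
    + apply: (@cvg_within_eq _ _ (fun w => P w *m J w)).
        by move=> w /insideE/Eo_in.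
      rewrite (jumpP _ z1).
      apply: cvg_mulmx; first by apply: PPm; exact/unit_circleE.
      by apply: cvg_within_restrict; exact: cJ.
    + apply: (@cvg_within_eq _ _ P); first by move=> w /outsideE/Eo_out.
      by apply: PPp; exact/unit_circleE.
    + apply: (@cvg_within_eq _ _ Pp); first by move=> w /unit_circleE/Eo_on.
      by move/subspace_continuousP : cPp; apply; exact/unit_circleE.
exists Ei, Eo; split; [split|exact: Ei_in|exact: Eo_out].
(* The inverse jump may be singular at 0, but [Ei] coincides with [P] there. *)
- move=> z; have [->|/dEi dEz] := eqVneq z 0; last exact: dEz.
  by apply: dEi0; rewrite cabs0 ltr01.
- exact: dEo.
- move=> z _; have [z1|z1|z1] := ltgtP (cabs z) 1.
  + by rewrite Eo_in// Ei_in.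
  + by rewrite Eo_out// Ei_out// -mulmxA J'J mulmx1.
  + by rewrite Eo_on// Ei_on// jumpP.
- move=> A /Pinf[M HM]; exists (Num.max 1 M) => w Mw /=.
  rewrite Eo_out; last first.
    by rewrite -ltcR -normr_cabs; apply: le_lt_trans Mw; rewrite lecR le_max lexx.
  by apply: HM; apply: le_lt_trans Mw; rewrite lecR le_max lexx orbT.
Qed.

(** Both continuations are continuous across the circle and serve as the boundary values, so their
    relation there is the jump condition. *)
Lemma pair_RHP_solution X T G B Ei Eo : analytic_pair X T G B Ei Eo ->
  RHP_solution X T G B (fun z => if 1 < cabs z then Eo z else Ei z).
Proof.
move=> [dEi dEo EoE Einf]; split; [|split].
- move=> z z1; have {}z1 : cabs z != 1 by apply/eqP => /unit_circleE.
  move: z1; rewrite neq_lt => /orP[z1|z1].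
    apply: (@derivable_mx_near _ _ Ei) (dEi z).
    by apply: filterS (cabs_lt1_near z1) => w w1; rewrite ltNge ltW.
  apply: (@derivable_mx_near _ _ Eo).
    by apply: filterS (cabs_gt1_near z1) => w ->.
  by apply: dEo; apply: neq0_cabs_ge1; exact: ltW.
- have cEi z : Ei w @[w --> z] --> Ei z.
    exact: (derivable_mx_continuous (dEi z)).
  have cEo z : unit_circle z -> Eo w @[w --> z] --> Eo z.
    move=> /unit_circleE z1; apply: derivable_mx_continuous; apply: dEo.
    by apply: neq0_cabs_ge1; rewrite z1.
  exists Eo, Ei; split.
  + split; first by apply/subspace_continuousP => z z1;
      apply: cvg_within_restrict; exact: cEo.
    move=> z z1; apply: (@cvg_within_eq _ _ Eo); first by move=> w /outsideE ->.
    by apply: cvg_within_restrict; exact: cEo.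
  + split; first by apply/subspace_continuousP => z z1;
      apply: cvg_within_restrict; exact: cEi.
    move=> z z1; apply: (@cvg_within_eq _ _ Ei).
      by move=> w /insideE w1; rewrite ltNge ltW.
    by apply: cvg_within_restrict; exact: cEi.
  + by move=> z /unit_circleE z1; apply: EoE; apply: neq0_cabs_ge1; rewrite z1.
- move=> A /Einf[M HM]; exists (Num.max 1 M) => w Mw /=.
  rewrite ifT; last first.
    by rewrite -ltcR -normr_cabs; apply: le_lt_trans Mw; rewrite lecR le_max lexx.
  by apply: HM; apply: le_lt_trans Mw; rewrite lecR le_max lexx orbT.
Qed.

(** * Rescaling of the variable, and uniqueness *)

Lemma cinfty_scale s (A : set C) : 0 < s -> cinfty A ->
  cinfty [set z | A (s%:C * z)].
Proof.
move=> s0 [M HM]; exists (M / s) => z Mz; apply: HM.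
rewrite normr_cabs ltcR cabsM cabs_real gtr0_norm//.
by move: Mz; rewrite normr_cabs ltcR ltr_pdivrMr// mulrC.
Qed.

Lemma derivable_mx_scale P s z : derivable P (s%:C * z) 1 ->
  derivable (fun w => P (s%:C * w)) z 1.
Proof.
move=> /derivable_mx2P dP; apply/derivable_mx2P => i j.
apply: (@derivable_chain R (fun w => P w i j) (fun w : C => s%:C * w) z _ (dP i j)).
apply: (@derivableM _ _ (fun=> s%:C : C) (fun w : C => w)).
  exact: derivable_cst.
exact: derivable_id.
Qed.

Lemma analytic_pair_scale X T G B s Ei Eo : 0 < s ->
  analytic_pair X T G B Ei Eo ->
  analytic_pair (s * X) (s ^+ 2 * T) G (B / s)
    (fun z => Ei (s%:C * z)) (fun z => Eo (s%:C * z)).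
Proof.
move=> s0 [dEi dEo EoE Einf].
have sn0 : s != 0 by rewrite gt_eqF.
have sz z : z != 0 -> s%:C * z != 0.
  by move=> z0; rewrite mulf_neq0// (inj_eq (@complexI R) s 0).
split.
- move=> z; exact: (derivable_mx_scale (dEi _)).
- move=> z z0; exact: (derivable_mx_scale (dEo _ (sz _ z0))).
- by move=> z /sz/EoE ->; rewrite jump_scale.
- move=> A LA; exact: (cinfty_scale s0 (Einf _ LA)).
Qed.

(** This is the property by which [RHP] selects its value. *)
Definition unique_solution X T G B P := RHP_solution X T G B P /\
  forall Q, RHP_solution X T G B Q ->
    forall z, ~ unit_circle z -> Q z = P z.

(** Cut along the circle, both pairs become solutions, which agree off it. Outside, cancelling the
    invertible jump carries the agreement over to the inner continuations; continuity settles the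
    circle. *)
Lemma unique_solution_pair X T G B P Ei Eo Fi Fo : G \in unitmx ->
  unique_solution X T G B P -> analytic_pair X T G B Ei Eo ->
  analytic_pair X T G B Fi Fo ->
  (forall z, Ei z = Fi z) /\ (forall z, z != 0 -> Eo z = Fo z).
Proof.
move=> uG [_ uP] pE pF.
have jK z : jump X T G B z *m jump X T (invmx G) B z = 1%:M.
  by rewrite jumpM mulmxV// jump1.
have EF z : cabs z != 1 -> Ei z = Fi z.
  move=> /eqP z1.
  have z1' : ~ unit_circle z by move/unit_circleE.
  have := uP _ (pair_RHP_solution pE) z z1'.
  rewrite -(uP _ (pair_RHP_solution pF) z z1').
  case: ifPn => // z2; have z0 : z != 0 by apply: neq0_cabs_ge1; exact: ltW.
  have [_ _ EoE _] := pE; have [_ _ FoE _] := pF.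
  rewrite EoE// FoE// => /(congr1 (fun M => M *m jump X T (invmx G) B z)).
  by rewrite /= -2!mulmxA jK !mulmx1.
have {}EF z : Ei z = Fi z.
  have [z1|/EF//] := eqVneq (cabs z) 1.
  have [dEi _ _ _] := pE; have [dFi _ _ _] := pF.
  apply/matrixP => i j; apply/eqP; rewrite -subr_eq0; apply/eqP.
  apply: (@continuous_eq0 _ [set w | cabs w != 1] (fun z => Ei z i j - Fi z i j)).
  - apply: (@for_continuousB _ (fun z => Ei z i j) (fun z => Fi z i j)).
      exact: (derivable_continuous ((derivable_mx2P _ _).1 (dEi z) i j)).
    exact: (derivable_continuous ((derivable_mx2P _ _).1 (dFi z) i j)).
  (* A radial shift by [e / 2] leaves the circle. *)
  - move=> e e0; exists (z + (e / 2)%:C * z).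
      rewrite /= -[X in X + _]mul1r -mulrDl cabsM z1 mulr1.
      rewrite -(rmorph1 (real_complex R)) -rmorphD/= cabs_real.
      rewrite ger0_norm ?gt_eqF ?ltrDl ?divr_gt0//.
      by rewrite addr_ge0 ?ler01 ?divr_ge0 ?ltW.
    rewrite addrC addKr cabsM z1 mulr1 cabs_real ger0_norm ?divr_ge0 ?ltW//; lra.
  - by apply: filterE => w /EF ->; rewrite subrr.
split=> // z z0; have [_ _ EoE _] := pE; have [_ _ FoE _] := pF.
by rewrite EoE// FoE// EF.
Qed.

(** Scaling moves the unit circle, so solutions are compared through their pairs: the pair of a
    competitor [Q] is scaled back by [s^-1] and must be the original one. *)
Lemma unique_solution_scale X T G B s P : G \in unitmx -> 0 < s ->
  unique_solution X T G B P ->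
  exists2 Q, unique_solution (s * X) (s ^+ 2 * T) G (B / s) Q &
    forall z, 1 < cabs z -> 1 < cabs (s%:C * z) -> Q z = P (s%:C * z).
Proof.
move=> uG s0 uP; have sn0 : s != 0 by rewrite gt_eqF.
have [Ei [Eo [pE EiP EoP]]] := RHP_solution_pair uG uP.1.
have pS := analytic_pair_scale s0 pE.
exists (fun z => if 1 < cabs z then Eo (s%:C * z) else Ei (s%:C * z)); last first.
  by move=> z -> /EoP.
split; first exact: pair_RHP_solution pS.
move=> Q /(RHP_solution_pair uG)[Fi [Fo [pF FiQ FoQ]]] z z1.
have {}z1 : cabs z != 1 by apply/eqP => /unit_circleE.
have := analytic_pair_scale _ pF (s := s^-1); rewrite invr_gt0 => /(_ s0).
rewrite mulKf// exprVn mulKf ?expf_neq0// invrK divfK// => pF'.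
have [EF EFo] := unique_solution_pair uG uP pE pF'.
have sK : (s^-1)%:C * (s%:C * z) = z.
  by rewrite mulrA -rmorphM/= mulVf// mul1r.
move: z1; rewrite neq_lt => /orP[z1|z1].
  by rewrite ltNge (ltW z1)/= EF sK FiQ.
rewrite z1 EFo ?sK ?FoQ// mulf_neq0 ?(inj_eq (@complexI R) s 0)//.
by apply: neq0_cabs_ge1; exact: ltW.
Qed.

Lemma RHP_unique X T G B P : unique_solution X T G B P ->
  unique_solution X T G B (RHP X T G B).
Proof. by move=> uP; rewrite /RHP; case: xgetP => [Q _ //|/(_ P)]; case. Qed.

Lemma RHP_not_unique X T G B : (forall P, ~ unique_solution X T G B P) ->
  RHP X T G B = fun=> 1%:M.
Proof. by move=> nP; rewrite /RHP; case: xgetP => // Q _ /nP. Qed.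

(** Unique solvability itself is invariant under rescaling, so either both values of [RHP] are
    solutions or both are the placeholder. *)
Lemma RHP_scale X T G B s : G \in unitmx -> 0 < s ->
  \forall z \near @cinfty R,
    RHP (s * X) (s ^+ 2 * T) G (B / s) z 0 1 = RHP X T G B (s%:C * z) 0 1.
Proof.
move=> uG s0; have [[P uP]|nP] := pselect (exists P, unique_solution X T G B P).
  have [Q uQ QP] := unique_solution_scale uG s0 (RHP_unique uP).
  (* Beyond this radius both [z] and [s%:C * z] lie outside the unit circle. *)
  exists (Num.max 1 s^-1) => z.
  rewrite normr_cabs ltcR gt_max => /andP[z1 zs].
  have z1' : ~ unit_circle z by move=> /unit_circleE zE; move: z1; rewrite zE ltxx.
  have sz1 : 1 < cabs (s%:C * z).
    by rewrite cabsM cabs_real gtr0_norm// -ltr_pdivrMl// mulr1.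
  have [uQ' _] := RHP_unique uQ.
  by rewrite -(QP _ z1 sz1) (uQ.2 _ uQ' _ z1').
have nP' Q : ~ unique_solution (s * X) (s ^+ 2 * T) G (B / s) Q.
  have sn0 : s != 0 by rewrite gt_eqF.
  move=> uQ; have s'0 : 0 < s^-1 by rewrite invr_gt0.
  have [P + _] := unique_solution_scale uG s'0 uQ.
  by rewrite mulKf// exprVn mulKf ?expf_neq0// invrK divfK// => uP; apply: nP; exists P.
have nP0 P : ~ unique_solution X T G B P by move=> uP; apply: nP; exists P.
rewrite (RHP_not_unique nP') (RHP_not_unique nP0).
(* The placeholder is constant, so both entries are the same off-diagonal entry of the identity. *)
by apply: filterE => z; rewrite !mxE.
Qed.

Lemma cvg_cinfty_scale (F : C -> C) s (l : C) : 0 < s ->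
  F @ @cinfty R --> l -> F (s%:C * z) @[z --> @cinfty R] --> l.
Proof. by move=> s0 Fl A LA; exact: (cinfty_scale s0 (Fl _ LA)). Qed.

End AnalyticPair.

(** * The limit at infinity under rescaling *)

Theorem proposition1p2 (R : realType) (G : 'M[R[i]^o]_2)
    (detG : \det G = 1)
    (symG : map_mx (@conjc R) G = sigma2 R *m G *m sigma2 R)
    (B : R) (B_gt0 : 0 < B) (X T : R) :
  Psi X T G B = B%:C * Psi (B * X) (B ^+ 2 * T) G 1.
Proof.
have uG : G \in unitmx by rewrite unitmxE detG unitr1.
have Bn0 : B != 0 by rewrite gt_eqF.
have BC0 : B%:C != 0 by rewrite (inj_eq (@complexI R) B 0).
have := RHP_scale X T B uG B_gt0; rewrite divff// /Psi.
set P := RHP X T G B; set Q := RHP _ _ G 1 => QP.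
pose F (z : R[i]^o) : R[i]^o := z * P z 0 1.
pose H (z : R[i]^o) : R[i]^o := z * Q z 0 1.
(* The factor [z] in front of the matrix entry is what produces the factor [B]. *)
have HF : \forall z \near @cinfty R, B%:C * H z = F (B%:C * z).
  by apply: filterS QP => z; rewrite /H /F => ->; rewrite mulrA.
change (2 * 'i%C * lim (F @ @cinfty R) =
  B%:C * (2 * 'i%C * lim (H @ @cinfty R)) :> R[i]^o).
clearbody F H.
have FH (l : R[i]^o) : F @ @cinfty R --> l -> H @ @cinfty R --> (B%:C^-1 * l : R[i]^o).
  move=> Fl; have FBl := cvg_cinfty_scale B_gt0 Fl.
  apply: cvg_trans (cvgM (cvg_cst (B%:C^-1 : R[i]^o)) FBl).
  apply: near_eq_cvg; apply: filterS HF => z /= <-.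
  by rewrite mulKf.
have Hcv (l : R[i]^o) : H @ @cinfty R --> l -> F @ @cinfty R --> (B%:C * l : R[i]^o).
  move=> Hl; have B'_gt0 : 0 < B^-1 by rewrite invr_gt0.
  have Hl' := cvg_cinfty_scale B'_gt0 Hl.
  apply: cvg_trans (cvgM (cvg_cst (B%:C : R[i]^o)) Hl').
  apply: near_eq_cvg; apply: filterS (cinfty_scale B'_gt0 HF) => z /= ->.
  by rewrite mulrA -rmorphM/= divff// mul1r.
rewrite mulrCA; congr (_ * _).
(* Convergence passes between [F] and [H] in both directions, so the two limits exist together or
   not at all. *)
have [cF|dF] := pselect (cvg (F @ @cinfty R)).
  have HE : lim (H @ @cinfty R) = (B%:C^-1 * lim (F @ @cinfty R) : R[i]^o).
    exact: (cvg_lim (@norm_hausdorff _ _) (FH _ cF)).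
  by rewrite HE mulVKf.
have dH : ~ cvg (H @ @cinfty R).
  move=> cH; apply: dF; apply/cvg_ex.
  by exists (B%:C * lim (H @ @cinfty R) : R[i]^o); exact: (Hcv _ cH).
(* Without convergence both limits take the default value 0, and the identity still holds. *)
rewrite (dvgP dF) (dvgP dH); exact/esym/mulr0.
Qed.
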